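(* Let $g(n,d)$ be the maximum $g$ such that every triangle-free graph with $n$ vertices and minimum degree at least $d$ contains an induced bipartite subgraph with minimum degree at least $g$. Then the following hold. (i) There are absolute constants $c,C>0$ such that for all sufficiently large $n$ and all integers $d$ with $3\le d\le \sqrt n$, $$c\,\frac{\log d}{\log\log d}\le g(n,d)\le C\log d .$$ (ii) For all integers $d$ with $\sqrt n<d\le n/2$ we have $g(n,d)\ge \dfrac{d^2}{2n}$; and there is an absolute constant $C>0$ such that for all sufficiently large $n$ and all integers $d$ with $\sqrt n<d\le n/2$, $$g(n,d)\le C\,\frac{d^2\log d}{n}.$$ (iii) For every fixed $\varepsilon\in(0,1/2]$ there are constants $c_\varepsilon,C_\varepsilon>0$ such that for all sufficiently large $n$ (depending on $\varepsilon$) and all integers $d$ with $n^{\varepsilon}\le d\le\sqrt n$, $$c_\varepsilon\log d\le g(n,d)\le C_\varepsilon\log d.$$ (iv) There are absolute constants $c,C>0$ such that for all sufficiently large $n$ and all integers $d$ with $n^{2/3}<d\le n/2$, $$c\,\frac{d^2}{n}\le g(n,d)\le C\,\frac{d^2}{n}.$$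
   Context: All graphs are finite and simple. An induced bipartite subgraph of $G$ is an induced subgraph $G[U]$, with $U\subseteq V(G)$ non-empty, that is bipartite. $\log$ is the natural logarithm. *)

(* Defs.v *)
From mathcomp Require Import all_boot all_order all_algebra.
From mathcomp Require Import boolp reals exp.

Set Implicit Arguments.
Unset Strict Implicit.
Unset Printing Implicit Defensive.

Record sgraph := SGraph {
  vertex :> finType;
  adj : rel vertex;
  adj_sym : symmetric adj;
  adj_irr : irreflexive adj }.

Definition degree (G : sgraph) (x : G) : nat := #|[set y | adj x y]|.

Definition min_degree_at_least (G : sgraph) (k : nat) : Prop :=
  forall x : G, k <= degree x.

Definition triangle_free (G : sgraph) : Prop :=
  forall x y z : G, ~ [/\ adj x y, adj y z & adj x z].

Definition bipartite (G : sgraph) : Prop :=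
  exists c : G -> bool, forall x y : G, adj x y -> c x != c y.

Section Induced.
Variables (G : sgraph) (U : {set G}).

Definition induced_adj : rel {x : G | x \in U} :=
  fun u v => adj (val u) (val v).

Fact induced_adj_sym : symmetric induced_adj.
Proof. by move=> u v; apply: adj_sym. Qed.

Fact induced_adj_irr : irreflexive induced_adj.
Proof. by move=> u; apply: adj_irr. Qed.

Definition induced : sgraph := SGraph induced_adj_sym induced_adj_irr.
End Induced.

Definition has_induced_bipartite (G : sgraph) (k : nat) : Prop :=
  exists U : {set G},
    [/\ U != set0, bipartite (induced U) & min_degree_at_least (induced U) k].

Definition forces_induced_bipartite (n d k : nat) : Prop :=
  forall G : sgraph, #|G| = n -> triangle_free G -> min_degree_at_least G d ->
    has_induced_bipartite G k.

(* If 2d > n no triangle-free graph on n vertices has minimum degree at least  *)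
(* d, so every k is forced and the maximum does not exist; the value of g is   *)
(* meaningful only for 0 < n and 2d <= n, where gP shows that the cut-off      *)
(* k <= n is harmless.                                                         *)
Definition g (n d : nat) : nat :=
  \max_(k < n.+1 | `[< forces_induced_bipartite n d k >]) k.

Section Balanced.
Variable n : nat.

Definition balanced_adj : rel 'I_n := fun x y => (x < n./2) != (y < n./2).

Fact balanced_adj_sym : symmetric balanced_adj.
Proof. by move=> x y; rewrite /balanced_adj eq_sym. Qed.

Fact balanced_adj_irr : irreflexive balanced_adj.
Proof. by move=> x; rewrite /balanced_adj eqxx. Qed.

Definition balanced : sgraph := SGraph balanced_adj_sym balanced_adj_irr.

Lemma balanced_triangle_free : triangle_free balanced.
Proof.
move=> x y z []; rewrite /= /balanced_adj.
by case: (x < _); case: (y < _); case: (z < _).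
Qed.

Lemma balanced_min_degree d : d.*2 <= n -> min_degree_at_least balanced d.
Proof.
move=> dn x; rewrite /degree /= /balanced_adj.
have hn : n./2 <= n by rewrite -{2}(odd_double_half n) -addnn addnA leq_addl.
have hh : (n./2).*2 <= n by rewrite -{2}(odd_double_half n) leq_addl.
have dh : d <= n./2 by rewrite -[d]doubleK half_leq.
have cardlt : #|[set y : 'I_n | y < n./2]| = n./2.
  rewrite -[RHS]card_ord -(card_imset (mem 'I_n./2) (f := widen_ord hn)).
    apply: eq_card => y; rewrite inE; apply/idP/imsetP => [yh|[z _ ->]] /=.
      by exists (Ordinal yh) => //; apply: val_inj.
    exact: ltn_ord.
  by move=> y z /(congr1 val) /= ?; apply: val_inj.
have cardge : #|[set y : 'I_n | ~~ (y < n./2)]| = n - n./2.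
  have -> : [set y : 'I_n | ~~ (y < n./2)] = ~: [set y : 'I_n | y < n./2].
    by apply/setP => y; rewrite !inE.
  by rewrite cardsCs setCK cardlt card_ord.
case: (x < n./2).
  rewrite (_ : [set _ | _] = [set y : 'I_n | ~~ (y < n./2)]).
    by rewrite cardge (leq_trans dh) // leq_subRL // addnn.
  by apply/setP => y; rewrite !inE; case: (y < _).
rewrite (_ : [set _ | _] = [set y : 'I_n | y < n./2]) ?cardlt //.
by apply/setP => y; rewrite !inE; case: (y < _).
Qed.
End Balanced.

Lemma has_induced_bipartite0 (G : sgraph) :
  0 < #|G| -> has_induced_bipartite G 0.
Proof.
case/card_gt0P => x _; exists [set x]; split=> [||u]; last exact: leq0n.
  by apply/set0Pn; exists x; rewrite inE.
exists xpredT => -[u uP] [v vP]; rewrite /= /induced_adj /=.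
by move: uP vP; rewrite !inE => /eqP-> /eqP->; rewrite adj_irr.
Qed.

Lemma has_induced_bipartite_leq (G : sgraph) (k : nat) :
  has_induced_bipartite G k -> k <= #|G|.
Proof.
case=> U [/set0Pn[x xU] _ /(_ (Sub x xU)) /leq_trans]; apply.
rewrite /degree (leq_trans (max_card _)) //= card_sig.
exact: max_card.
Qed.

Lemma gP (n d : nat) : 0 < n -> d.*2 <= n ->
  forces_induced_bipartite n d (g n d) /\
  forall k, forces_induced_bipartite n d k -> k <= g n d.
Proof.
move=> n0 dn; split=> [|k fk].
  have f0 : `[< forces_induced_bipartite n d (ord0 : 'I_n.+1) >].
    by apply/asboolP => G Gn _ _; apply: has_induced_bipartite0; rewrite Gn.
  rewrite /g (bigmax_eq_arg _ f0) //.
  by case: arg_maxnP => // i /asboolP.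
have kn : k < n.+1.
  rewrite ltnS -[n]card_ord; apply: (@has_induced_bipartite_leq (balanced n)).
  apply: fk; [exact: card_ord|exact: balanced_triangle_free|].
  exact: balanced_min_degree.
by rewrite /g; apply: (leq_bigmax_cond (Ordinal kn)); apply/asboolP.
Qed.

(* Main.v *)
Require Import Defs.
From mathcomp Require Import all_boot all_order all_algebra all_field.
From mathcomp Require Import boolp reals exp.
From mathcomp Require Import zify ring lra.

(** Why the theorem holds.

An induced bipartite subgraph is the union of two independent sets, so both
directions are about edges between pairs of independent sets.

Lower bounds.  Suppose that a graph of minimum degree [d] carries a random
independent set containing each vertex with probability at least [q].  Two
independent samples [I] and [J] span at least [d * q / 2] edges per vertex on
average, and a pair attaining the average contains a subgraph of minimum degree
[d * q / 2] ([bipartite_of_random_independent]).  In a triangle-free graph the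
neighbourhood of a random vertex has [q = d / n], which gives [d ^ 2 / (2 n)].
Logarithmic bounds need [q] of order ln d / d.  A triangle-free graph may first
be replaced by an induced subgraph with minimum degree and degeneracy both equal
to some [D >= d].  In a [D]-degenerate triangle-free graph, a greedy random
process along the ordering, whose selection probabilities are rescaled so as to
remain martingales, selects each vertex with probability at least ln D / (16 D)
([degenerate_random_independent]).  Hence [g n d] is at least ln d / 32
([g_lower_log]).

Upper bounds.  They come from two graphs.  The first is a random graph on
[m = L ^ 2] vertices with edge probability of order [1 / L], made triangle-free
by deleting a maximal family of edge-disjoint triangles.  Its minimum degree is
of order [L]; its independent sets have at most O(L ln L) vertices, and sets of
this size span only O(ln L) edges per vertex, so an induced bipartite subgraph
has minimum degree O(ln L) ([random_triangle_free]).  The second is a Cayley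
graph on [F ^ 3], for a field [F] of order [q = 2 ^ k], with degree about
[q ^ 2 / 2] and all nontrivial eigenvalues O(q).  By the expander mixing lemma
its induced bipartite subgraphs have minimum degree at most [3 q]
([pseudorandom_triangle_free]).  Disjoint copies and balanced blow-ups
([g_le_blowup]) transport these graphs to all [n] and [d]: a blow-up by a
factor [t] multiplies the order, the minimum degree and the bound by [t].  For
[d <= sqrt n] copies of the random graph are used, for larger [d] its blow-ups,
and for [d > n ^ (2/3)] blow-ups of the Cayley graph. *)

Set Implicit Arguments.
Unset Strict Implicit.
Unset Printing Implicit Defensive.

Import Order.TTheory GRing.Theory Num.Theory.
Local Open Scope ring_scope.

(** * Induced bipartite subgraphs as unions of two independent sets *)

Definition nbr_in (G : sgraph) (U : {set G}) (x : G) : nat :=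
  #|[set y in U | adj x y]|.

Definition independent (G : sgraph) (I : {set G}) : Prop :=
  {in I &, forall x y, ~~ adj x y}.

Lemma independentS (G : sgraph) (I J : {set G}) :
  I \subset J -> independent J -> independent I.
Proof. by move=> /subsetP IJ indJ x y /IJ xJ /IJ yJ; exact: indJ. Qed.

Lemma nbr_inT (G : sgraph) (x : G) : nbr_in setT x = degree x.
Proof. by apply: eq_card => y; rewrite !inE. Qed.

Lemma nbr_in_sum (G : sgraph) (U : {set G}) x :
  nbr_in U x = (\sum_(y in U) adj x y)%N.
Proof.
rewrite /nbr_in -sum1_card big_mkcond [RHS]big_mkcond.
by apply: eq_bigr => y _; rewrite inE; case: (y \in U); case: (adj x y).
Qed.

(** The two colour classes form the pair of independent sets.  Allowing them to
overlap is harmless, since a vertex of the overlap is isolated in the union,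
and it makes the characterisation convenient for sets sampled independently of
each other. *)
Lemma has_induced_bipartiteP (G : sgraph) (k : nat) :
  has_induced_bipartite G k <->
  exists A B : {set G}, [/\ A :|: B != set0, independent A, independent B
    & forall x, x \in A :|: B -> (k <= nbr_in (A :|: B) x)%N].
Proof.
have degE (U : {set G}) (x : G) (xU : x \in U) :
    @degree (induced U) (Sub x xU) = nbr_in U x.
  rewrite /degree /nbr_in -(card_imset _ val_inj); apply: eq_card => y.
  rewrite !inE; apply/imsetP/andP => [[z]|[yU xy]].
    by rewrite inE => /= xz ->; split => //; exact: (valP z).
  by exists (Sub y yU); rewrite ?inE.
split=> [[U [U0 [c cP] degU]]|[A [B [AB0 iA iB degAB]]]].
  pose A := [set x in U | [exists xU : {x | x \in U}, (val xU == x) && c xU]].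
  have AU : A \subset U by apply/subsetP => x; rewrite inE => /andP[].
  have inA x (xU : x \in U) : (x \in A) = c (Sub x xU).
    rewrite inE xU /=; apply/existsP/idP => [[z /andP[/eqP zx cz]]|cx].
      by rewrite (_ : Sub x xU = z) //; apply: val_inj.
    by exists (Sub x xU); rewrite eqxx.
  exists A, (U :\: A).
  have -> : A :|: (U :\: A) = U.
    by rewrite setUC setDE setUIl setUC (setUidPr AU) setUC setUCr setIT.
  split=> // [x y xA yA|x y|x xU]; last by rewrite -(degE _ _ xU).
  - have xU := subsetP AU x xA; have yU := subsetP AU y yA.
    apply/negP => xy; have := cP (Sub x xU) (Sub y yU) xy.
    by rewrite -!inA xA yA.
  - rewrite !in_setD; move=> /andP[xA xU] /andP[yA yU].
    apply/negP => xy; have := cP (Sub x xU) (Sub y yU) xy.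
    by rewrite -!inA (negPf xA) (negPf yA).
exists (A :|: B); split=> //; last first.
  by move=> -[x xU]; rewrite (degE _ _ xU); exact: degAB.
exists (fun z => val z \in A) => -[x xU] [y yU] /= xy.
have {}xy : adj x y by [].
move: xU yU; rewrite !inE.
case: (boolP (x \in A)) => xA; case: (boolP (y \in A)) => yA //= xB yB.
  by move: (iA _ _ xA yA); rewrite xy.
by move: (iB _ _ xB yB); rewrite xy.
Qed.

(** A graph with more than [K] edges per vertex has a subgraph of minimum degree
above [K]: in a smallest vertex set with more than [K] edges per vertex, the
deletion of a vertex of degree at most [K] would keep that density.  Edge
counts are over ordered pairs, whence the factors 2. *)
Lemma bipartite_of_dense_pair (G : sgraph) (I J : {set G}) (K : nat) :
    independent I -> independent J ->
    (K * (#|I| + #|J|) < \sum_(x in I) nbr_in J x)%N ->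
  has_induced_bipartite G K.+1.
Proof.
move=> iI iJ eIJ.
pose f (W : {set G}) := (\sum_(x in W) nbr_in W x)%N.
pose P (W : {set G}) := (K * #|W| * 2 < f W)%N.
have fE W : f W = (\sum_x \sum_y [&& x \in W, y \in W & adj x y])%N.
  rewrite /f big_mkcond; apply: eq_bigr => x _; case: (x \in W) => /=.
    by rewrite nbr_in_sum big_mkcond; apply: eq_bigr => y _; case: (y \in W).
  by rewrite big1.
have PIJ : P (I :|: J).
  rewrite /P; apply: (@leq_trans (2 * (K * (#|I| + #|J|))).+1).
    by rewrite ltnS mulnC leq_mul2l leq_mul2l cardsU leq_subr orbT.
  have e2 : (\sum_(x in I) nbr_in J x = \sum_x \sum_y [&& x \in I, y \in J & adj x y])%N.
    rewrite big_mkcond; apply: eq_bigr => x _; case: (x \in I) => /=.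
      by rewrite nbr_in_sum big_mkcond; apply: eq_bigr => y _; case: (y \in J).
    by rewrite big1.
  have e3 : (\sum_(x in I) nbr_in J x = \sum_x \sum_y [&& x \in J, y \in I & adj x y])%N.
    rewrite e2 exchange_big; apply: eq_bigr => x _; apply: eq_bigr => y _.
    by rewrite andbCA adj_sym.
  apply: (@leq_trans (2 * \sum_(x in I) nbr_in J x)).
    by rewrite ltn_pmul2l.
  rewrite mul2n -addnn {1}e2 e3 fE -big_split leq_sum // => x _.
  rewrite -big_split leq_sum // => y _; rewrite !inE.
  case: (boolP (adj x y)) => [xy|_]; last by rewrite !andbF.
  rewrite !andbT; case: (boolP (x \in I)) => xI; case: (boolP (x \in J)) => xJ;
    case: (boolP (y \in I)) => yI; case: (boolP (y \in J)) => yJ //=;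
    by [move: (iI _ _ xI yI); rewrite xy | move: (iJ _ _ xJ yJ); rewrite xy].
have [W /minsetP[PW minW] WIJ] := minset_exists PIJ.
apply/has_induced_bipartiteP; exists (W :&: I), (W :&: J).
rewrite -setIUr (setIidPl WIJ); split.
- by apply: contraTneq PW => ->; rewrite /P /f cards0 big_set0 muln0.
- exact: independentS (subsetIr _ _) iI.
- exact: independentS (subsetIr _ _) iJ.
move=> x xW; rewrite ltnNge; apply/negP => degx.
suff PWx : P (W :\ x).
  have /setP/(_ x) := minW _ PWx (subsetDl _ _).
  by rewrite !inE eqxx xW.
move: PW; rewrite /P; have := cardsD1 x W; rewrite xW => cW.
suff : (f W = f (W :\ x) + nbr_in W x * 2)%N by lia.
rewrite /f (big_setD1 x) //= [in RHS]addnC muln2 -addnn -addnA; congr (_ + _)%N.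
rewrite [X in (X + _)%N](_ : _ = \sum_(y in W :\ x) adj y x)%N.
  rewrite -big_split; apply: eq_bigr => y _ /=.
  by rewrite !nbr_in_sum (big_setD1 x).
rewrite nbr_in_sum (big_setD1 x) //= adj_irr add0n.
by apply: eq_bigr => y _; rewrite adj_sym.
Qed.

(** First moment over a pair of samples.  [D] lists the outcomes of a random
independent set with their weights.  If every vertex is selected with
probability at least [q], then two independent samples [I] and [J] satisfy
E e(I, J) >= d q E|I| = (d q / 2) E(|I| + |J|), so some pair is dense enough to
contain the required subgraph. *)
Lemma bipartite_of_random_independent (R : realFieldType) (G : sgraph)
    (U : {set G}) (D : seq (R * {set G})) (d K : nat) (q : R) :
    U != set0 -> (forall x, x \in U -> (d <= nbr_in U x)%N) ->
    (forall wI, wI \in D -> [/\ 0 <= wI.1, wI.1 != 0 -> independent wI.2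
       & wI.2 \subset U]) ->
    0 < \sum_(wI <- D) wI.1 ->
    (forall x, x \in U -> q * (\sum_(wI <- D) wI.1)
       <= \sum_(wI <- D) wI.1 * (x \in wI.2)%:R) ->
    K%:R < d%:R * q / 2 ->
  has_induced_bipartite G K.+1.
Proof.
move=> U0 degU DP W0 qP Kq; apply: contrapT => noK.
set W := \sum_(wI <- D) _ in W0 qP.
pose P x : R := \sum_(wI <- D) wI.1 * (x \in wI.2)%:R.
have q0 : 0 < q.
  rewrite ltNge; apply/negP => q0; have : 0 < d%:R * q / 2 by apply: le_lt_trans Kq.
  by rewrite ltNge; apply/negP/negPn; rewrite pmulr_lle0 ?invr_gt0 // mulr_ge0_le0.
pose e (I J : {set G}) := (\sum_(x in I) nbr_in J x)%N.
have ub : \sum_(a <- D) \sum_(b <- D) a.1 * b.1 * (e a.2 b.2)%:R <=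
    \sum_(a <- D) \sum_(b <- D) a.1 * b.1 * (K * (#|a.2| + #|b.2|))%:R.
  rewrite big_seq [leRHS]big_seq; apply: ler_sum => a aD.
  rewrite big_seq [leRHS]big_seq; apply: ler_sum => b bD.
  have [a0 aI _] := DP _ aD; have [b0 bI _] := DP _ bD.
  have [->|an] := eqVneq a.1 0; first by rewrite !mul0r.
  have [->|bn] := eqVneq b.1 0; first by rewrite mulr0 !mul0r.
  rewrite ler_wpM2l ?mulr_ge0 // ler_nat leqNgt; apply/negP => eK.
  exact/noK/(bipartite_of_dense_pair (aI an) (bI bn) eK).
have eE (I J : {set G}) : I \subset U -> J \subset U ->
    (e I J)%:R = \sum_(x in U) \sum_(y in U | adj x y) (x \in I)%:R * (y \in J)%:R :> R.
  move=> /subsetP IU /subsetP JU; rewrite /e big_mkcond natr_sum.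
  rewrite [RHS]big_mkcond; apply: eq_bigr => x _.
  case: (boolP (x \in I)) => xI; last first.
    by case: ifP => // _; rewrite big1 // => y _; rewrite mul0r.
  rewrite (IU _ xI) nbr_in_sum natr_sum big_mkcond [RHS]big_mkcond.
  apply: eq_bigr => y _; rewrite mul1r.
  case: (boolP (y \in J)) => yJ; first by rewrite (JU _ yJ) /=; case: (adj x y).
  by case: ifP.
have cardE (I : {set G}) : I \subset U -> #|I|%:R = \sum_(x in U) (x \in I)%:R :> R.
  move=> /subsetP IU; rewrite -sum1_card natr_sum big_mkcond [RHS]big_mkcond.
  apply: eq_bigr => x _; case: (boolP (x \in I)) => xI; first by rewrite (IU _ xI).
  by case: ifP.
have lhs : \sum_(a <- D) \sum_(b <- D) a.1 * b.1 * (e a.2 b.2)%:R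
    = \sum_(x in U) \sum_(y in U | adj x y) P x * P y.
  transitivity (\sum_(a <- D) \sum_(b <- D) \sum_(x in U) \sum_(y in U | adj x y)
      (a.1 * (x \in a.2)%:R) * (b.1 * (y \in b.2)%:R)).
    rewrite big_seq [RHS]big_seq; apply: eq_bigr => a aD.
    rewrite big_seq [RHS]big_seq; apply: eq_bigr => b bD.
    have [_ _ aU] := DP _ aD; have [_ _ bU] := DP _ bD.
    rewrite eE // mulr_sumr; apply: eq_bigr => x _.
    by rewrite mulr_sumr; apply: eq_bigr => y _; rewrite mulrACA.
  under eq_bigr do rewrite exchange_big; rewrite exchange_big.
  apply: eq_bigr => x _; under eq_bigr do rewrite exchange_big.
  rewrite exchange_big; apply: eq_bigr => y _; rewrite /P mulr_suml.
  by apply: eq_bigr => a _; rewrite mulr_sumr.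
have SP : \sum_(a <- D) a.1 * #|a.2|%:R = \sum_(x in U) P x.
  rewrite /P exchange_big big_seq [RHS]big_seq; apply: eq_bigr => a aD.
  by have [_ _ aU] := DP _ aD; rewrite cardE // mulr_sumr.
have rhs : \sum_(a <- D) \sum_(b <- D) a.1 * b.1 * (K * (#|a.2| + #|b.2|))%:R
    = 2 * K%:R * W * \sum_(x in U) P x.
  rewrite -SP; transitivity (\sum_(a <- D) (K%:R * (W * (a.1 * #|a.2|%:R))
     + K%:R * (a.1 * \sum_(b <- D) b.1 * #|b.2|%:R))).
    apply: eq_bigr => a _; rewrite /W mulr_suml !mulr_sumr -big_split.
    by apply: eq_bigr => b _ /=; rewrite natrM natrD; ring.
  rewrite big_split /= -!mulr_sumr -mulr_suml -/W; ring.
have P0 x : x \in U -> 0 < P x.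
  by move=> xU; apply: lt_le_trans (qP _ xU); rewrite mulr_gt0.
have SP0 : 0 < \sum_(x in U) P x.
  case/set0Pn: U0 => z zU; rewrite (bigD1 z) //= ltr_pwDl ?P0 //.
  by apply: sumr_ge0 => x /andP[xU _]; rewrite ltW ?P0.
have : d%:R * q * W * \sum_(x in U) P x <= 2 * K%:R * W * \sum_(x in U) P x.
  rewrite -rhs; apply: le_trans ub; rewrite lhs mulr_sumr; apply: ler_sum => x xU.
  rewrite -mulr_sumr [leLHS]mulrC (ler_wpM2l (ltW (P0 _ xU))) //.
    apply: (@le_trans _ _ (\sum_(y in U | adj x y) q * W)).
    rewrite sumr_const -[leRHS]mulr_natl -mulrA ler_pM2r ?mulr_gt0 // ler_nat.
    by apply: leq_trans (degU _ xU) _; rewrite /nbr_in; apply/eq_leq/eq_card => y; rewrite !inE.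
  by apply: ler_sum => y /andP[yU _]; exact: qP.
rewrite ler_pM2r // ler_pM2r // leNgt => /negP; apply.
by rewrite mulrC -ltr_pdivlMr.
Qed.

(** In a triangle-free graph the neighbourhood of a uniformly random vertex is a
random independent set that contains each vertex with probability at least
[d / n]. *)
Lemma bipartite_of_neighbourhoods (G : sgraph) (d K : nat) :
    (0 < #|G|)%N -> triangle_free G -> min_degree_at_least G d ->
    (K * (2 * #|G|) < d ^ 2)%N ->
  has_induced_bipartite G K.+1.
Proof.
move=> n0 tf degG Kd; have nR : 0 < #|G|%:R :> rat by rewrite ltr0n.
pose D := [seq ((1 : rat), [set y | adj u y]) | u <- enum G].
have W : \sum_(wI <- D) wI.1 = #|G|%:R.
  by rewrite big_map big_enum /= sumr_const.
apply: (@bipartite_of_random_independent _ _ setT D d _ (d%:R / #|G|%:R)).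
- by case/card_gt0P: n0 => x _; apply/set0Pn; exists x.
- by move=> x _; rewrite nbr_inT.
- move=> _ /mapP[u _ ->]; split=> // _ x y; rewrite !inE => ux uy.
  by apply/negP => xy; apply: (tf u x y).
- by rewrite W.
- move=> x _; rewrite W divfK ?gt_eqF // big_map big_enum /=.
  rewrite (eq_bigr (fun u => (adj x u)%:R)); last first.
    by move=> u _; rewrite mul1r inE adj_sym.
  rewrite -natr_sum ler_nat; apply: leq_trans (degG x) _.
  by rewrite -nbr_inT nbr_in_sum; apply: eq_leq; apply: eq_bigl => y; rewrite inE.
- rewrite mulrA -mulrA -invfM ltr_pdivlMr ?mulr_gt0 //.
  by rewrite -expr2 -natrX [_ * 2]mulrC -!natrM ltr_nat.
Qed.

(** * Degeneracy orderings *)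

Section Degeneracy.
Variable G : sgraph.

Definition back_bounded (s : seq G) (D : nat) : Prop :=
  forall x, x \in s -> (count (adj x) (take (index x s) s) <= D)%N.

Lemma degenerate_order (U : {set G}) (D : nat) :
    (forall W : {set G}, W \subset U -> W != set0 ->
       exists2 x, x \in W & (nbr_in W x <= D)%N) ->
  exists s : seq G, [/\ uniq s, s =i U & back_bounded s D].
Proof.
elim/ltn_ind: {U}#|U| {-2}U (erefl #|U|) => n IH U Un degU.
have [->|U0] := eqVneq U set0.
  by exists [::]; split=> // x; rewrite inE.
have [x xU degx] := degU _ (subxx _) U0.
have cU : (#|U :\ x| < n)%N by rewrite -Un (cardsD1 x U) xU.
have [|s [us sU bs]] := IH _ cU (U :\ x) erefl.
  by move=> W WU; apply: degU; apply: subset_trans WU (subsetDl _ _).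
have xs : x \notin s by rewrite sU !inE eqxx.
exists (rcons s x); split.
- by rewrite rcons_uniq xs.
- by move=> y; rewrite mem_rcons inE sU !inE; case: eqVneq => // ->.
move=> y; rewrite mem_rcons inE -cats1 index_cat; case: (boolP (y \in s)) => [ys _|ys].
  by rewrite takel_cat ?bs // index_size.
rewrite orbF => /eqP->; rewrite /= eqxx addn0 take_size_cat //.
apply: leq_trans degx; rewrite -size_filter -(card_uniqP _) ?filter_uniq //.
apply/subset_leq_card/subsetP => z; rewrite mem_filter inE sU !inE.
by case/andP=> -> /andP[_ ->].
Qed.

(** Take the largest [D] for which some nonempty [U] induces minimum degree at
least [D]: then no subset of [U] has larger minimum degree, and removing
vertices of small degree one after the other orders [U].  This confines large
degrees to one direction of the ordering at no cost in the minimum degree. *)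
Lemma degeneracy_witness (d : nat) : (0 < #|G|)%N -> min_degree_at_least G d ->
  exists D (U : {set G}) (s : seq G), [/\ (d <= D)%N, U != set0,
    forall x, x \in U -> (D <= nbr_in U x)%N, uniq s & s =i U /\ back_bounded s D].
Proof.
move=> n0 degG.
pose P D := [exists U : {set G}, (U != set0) && [forall x in U, D <= nbr_in U x]%N].
have Pd : P d.
  apply/existsP; exists setT; apply/andP; split.
    by case/card_gt0P: n0 => x _; apply/set0Pn; exists x.
  by apply/forall_inP => x _; rewrite nbr_inT degG.
have Pb D : P D -> (D <= #|G|)%N.
  case/existsP => U /andP[/set0Pn[x xU] /forall_inP/(_ x xU)] /leq_trans; apply.
  exact: max_card.
case: (ex_maxnP (ex_intro _ d Pd) Pb) => D PD maxD.
have dD := maxD _ Pd; case/existsP: PD => U /andP[U0 /forall_inP degU].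
have [|s [us sU bs]] := @degenerate_order U D.
  move=> W WU W0; apply/exists_inP; rewrite -[X in is_true X]negbK negb_exists_in.
  apply/negP => /forall_inP degW; suff /maxD : P D.+1 by rewrite ltnn.
  apply/existsP; exists W; rewrite W0; apply/forall_inP => x /degW.
  by rewrite -ltnNge.
by exists D, U, s; split.
Qed.

End Degeneracy.

(** * Random independent sets in degenerate triangle-free graphs *)

Section Sampling.
Variables (R : realType) (G : sgraph).
Implicit Types (w : G -> R) (s : seq G).

(** The sampling process treats the vertices along a degeneracy ordering.  Each
vertex carries a weight, the tentative probability of being selected.  If [v]
is selected, the weights of its neighbours drop to 0; otherwise they are
divided by one minus the selection probability.  All weights are therefore
martingales.  A weight above 1/2 is read as 0, so that the division makes
sense. *)
Definition trunc (x : R) : R := if x <= 1 / 2 then x else 0.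

Definition reject w v : G -> R :=
  fun u => if adj v u then w u / (1 - trunc (w v)) else w u.

Definition accept w v : G -> R := fun u => if adj v u then 0 else w u.

Fixpoint sample s w : seq (R * {set G}) :=
  if s is v :: s' then
    [seq (trunc (w v) * a.1, v |: a.2) | a <- sample s' (accept w v)] ++
    [seq ((1 - trunc (w v)) * a.1, a.2) | a <- sample s' (reject w v)]
  else [:: (1, set0)].

Lemma trunc_ge0 x : 0 <= x -> 0 <= trunc x.
Proof. by rewrite /trunc; case: ifP. Qed.

Lemma trunc_le x : 0 <= x -> trunc x <= x.
Proof. by rewrite /trunc; case: ifP. Qed.

Lemma trunc_half x : trunc x <= 1 / 2.
Proof. by rewrite /trunc; case: ifP => // _; lra. Qed.

Lemma accept_ge0 w v : (forall u, 0 <= w u) -> forall u, 0 <= accept w v u.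
Proof. by move=> w0 u; rewrite /accept; case: ifP. Qed.

Lemma reject_ge0 w v : (forall u, 0 <= w u) -> forall u, 0 <= reject w v u.
Proof.
move=> w0 u; rewrite /reject; case: ifP => // _.
by rewrite divr_ge0 // subr_ge0 (le_trans (trunc_half _)) //; lra.
Qed.

Lemma sample_total s w : \sum_(a <- sample s w) a.1 = 1.
Proof.
elim: s w => [|v s IH] w; first by rewrite big_seq1.
rewrite big_cat !big_map /= -!mulr_sumr !IH; ring.
Qed.

Lemma sampleP s w : (forall u, 0 <= w u) ->
  forall a, a \in sample s w -> [/\ 0 <= a.1, {subset a.2 <= s} & a.1 != 0 ->
     independent a.2 /\ forall u, u \in a.2 -> w u != 0].
Proof.
elim: s w => [|v s IH] w w0 a.
  rewrite inE => /eqP->; split=> [|x|_]; [exact: ler01|by rewrite inE|].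
  by split=> [x y|x]; rewrite inE.
rewrite mem_cat => /orP[] /mapP[b bs ->] /=.
- have [b0 bsub bind] := IH _ (accept_ge0 v w0) _ bs.
  split; first by rewrite mulr_ge0 ?trunc_ge0.
    move=> x; rewrite !inE => /orP[->//|/bsub ->]; exact: orbT.
  rewrite mulf_eq0 negb_or => /andP[a0 /bind[indb bn]].
  have nv x : x \in b.2 -> ~~ adj v x /\ w x != 0.
    by move/bn; rewrite /accept; case: (adj v x); rewrite ?eqxx.
  split=> [x y|x].
    rewrite !inE => /orP[/eqP->|xb] /orP[/eqP->|yb].
    + by rewrite adj_irr.
    + by case: (nv _ yb).
    + by rewrite adj_sym; case: (nv _ xb).
    + exact: indb.
  rewrite !inE => /orP[/eqP->|/nv[] //].
  by apply: contraNneq a0; rewrite /trunc => ->; case: ifP.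
- have [b0 bsub bind] := IH _ (reject_ge0 v w0) _ bs.
  have h := trunc_half (w v).
  split; first by rewrite mulr_ge0 // subr_ge0; lra.
    by move=> x /bsub; rewrite inE orbC => ->.
  rewrite mulf_eq0 negb_or => /andP[a0 /bind[indb bn]]; split=> // x /bn.
  by rewrite /reject; case: ifP => // _; apply: contraNneq => ->; rewrite mul0r.
Qed.

Definition incl u s w : R := \sum_(a <- sample s w) a.1 * (u \in a.2)%:R.

Lemma incl_notin u s w : (forall u, 0 <= w u) -> u \notin s -> incl u s w = 0.
Proof.
move=> w0 us; rewrite /incl big_seq big1 // => a /(sampleP w0)[_ sub _].
by case: (boolP (u \in a.2)) => [/sub|]; rewrite ?(negPf us) ?mulr0.
Qed.

Lemma incl_ge0 u s w : (forall u, 0 <= w u) -> 0 <= incl u s w.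
Proof.
move=> w0; rewrite /incl big_seq sumr_ge0 // => a /(sampleP w0)[a0 _ _].
by rewrite mulr_ge0 // ler0n.
Qed.

Lemma incl_head u s w : (forall u, 0 <= w u) -> u \notin s ->
  incl u (u :: s) w = trunc (w u).
Proof.
move=> w0 us; rewrite /incl /= big_cat !big_map /=.
under eq_bigr do rewrite !inE eqxx mulr1.
rewrite -mulr_sumr sample_total mulr1.
under eq_bigr do rewrite -mulrA.
by rewrite -mulr_sumr [X in _ * X](incl_notin (reject_ge0 _ w0)) // mulr0 addr0.
Qed.

Lemma incl_cons u v s w : v != u ->
  incl u (v :: s) w = trunc (w v) * incl u s (accept w v)
                    + (1 - trunc (w v)) * incl u s (reject w v).
Proof.
move=> vu; rewrite /incl /= big_cat !big_map /= !mulr_sumr.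
congr (_ + _); apply: eq_bigr => a _; rewrite -?mulrA //.
by rewrite !inE eq_sym (negPf vu).
Qed.

Definition back_sum u s w : R := \sum_(v <- take (index u s) s | adj u v) w v.

Lemma back_sum_cons u v s w : v != u ->
  back_sum u (v :: s) w = (if adj u v then w v else 0) + back_sum u s w.
Proof.
move=> vu; rewrite /back_sum /= (negPf vu) big_cons; case: ifP => //.
by rewrite add0r.
Qed.

Lemma ln_le_reject (a : R) : 0 <= a <= 1 / 2 -> ln ((1 - a)^-1) <= 2 * a.
Proof.
move=> /andP[a0 a1]; have a2 : 0 < 1 - a by lra.
have -> : (1 - a)^-1 = 1 + a / (1 - a) by field; lra.
apply: le_trans (le_ln1Dx _) _.
  by apply: (@lt_le_trans _ _ 0); [lra|rewrite divr_ge0 // ltW].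
by rewrite ler_pdivrMr //; nra.
Qed.

Hypothesis tf : triangle_free G.

(** Selecting [u] requires that all its earlier neighbours be rejected, and the
weight of [u] exactly compensates for the probability of these rejections.  So
the inclusion probability of [u] is its weight times the probability, under
the process forced to reject the neighbours of [u], that the final weight of
[u] is at most 1/2.  In the forced process,
   ln (w u) + 2 (sum of the weights of the earlier neighbours of u)
is a supermartingale.  A rejection of [v] moves at most twice the weight of [v]
from the sum to the logarithm.  The other weights in the sum stay martingales
because two neighbours of [u] are never adjacent, so that the forced rejections
do not disturb them.  Markov's inequality for this potential gives the
bound. *)
Lemma incl_lower (p L : R) u s w : 0 < p -> ln p + L = ln (1 / 2) -> 0 < L ->
    uniq s -> u \in s -> (forall v, 0 <= w v) -> p <= w u ->
  w u * (1 - (ln (w u) - ln p + 2 * back_sum u s w) / L) <= incl u s w.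
Proof.
move=> p0 pL L0; elim: s w => // v s IH w /= /andP[vs us].
rewrite inE => uvs w0 pw; have wu0 : 0 < w u by apply: lt_le_trans pw.
have [vu|vu] := eqVneq v u.
  rewrite {}vu in vs *; rewrite incl_head // /back_sum /= eqxx big_nil mulr0 addr0.
  rewrite /trunc; case: ifPn => [wh|]; last rewrite -ltNge => wh.
    rewrite ger_pMr // lerBlDr lerDl divr_ge0 ?(ltW L0) //.
    by rewrite subr_ge0 ler_ln ?posrE.
  rewrite pmulr_rle0 // subr_le0 ler_pdivlMr // mul1r lerBrDr addrC pL.
  by rewrite ler_ln ?posrE ?ltW //; lra.
have {}uvs : u \in s by move: uvs; rewrite eq_sym (negPf vu).
rewrite incl_cons // back_sum_cons //.
set a := trunc (w v); have a0 : 0 <= a by apply: trunc_ge0.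
have ah : a <= 1 / 2 := trunc_half _; have aw : a <= w v by apply: trunc_le.
have a1 : 0 < 1 - a by lra.
case: (boolP (adj u v)) => uv.
  have rE : reject w v u = w u / (1 - a) by rewrite /reject adj_sym uv.
  have wr : w u <= reject w v u.
    by rewrite rE ler_pdivlMr // ger_pMr //; lra.
  have := IH (reject w v) us uvs (reject_ge0 v w0) (le_trans pw wr).
  have -> : back_sum u s (reject w v) = back_sum u s w.
    apply: eq_bigr => z uz; rewrite /reject; case: ifP => // vz.
    by case: (tf (And3 uv vz uz)).
  rewrite rE lnM ?posrE ?invr_gt0 //.
  have := @ln_le_reject a; rewrite a0 ah => /(_ isT) lna IHr.
  apply: (@le_trans _ _ ((1 - a) * incl u s (reject w v))); last first.
    by rewrite lerDr mulr_ge0 // incl_ge0 //; apply: accept_ge0.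
  rewrite -ler_pdivrMl // mulrA; apply: le_trans IHr.
  rewrite [_^-1 * _]mulrC ler_pM2l ?divr_gt0 // lerB // ler_pM2r ?invr_gt0 //.
  by move: lna aw; set x := ln (_^-1); lra.
have aE : accept w v u = w u by rewrite /accept adj_sym (negPf uv).
have rE : reject w v u = w u by rewrite /reject adj_sym (negPf uv).
have := IH (accept w v) us uvs (accept_ge0 v w0); rewrite aE => /(_ pw) IHa.
have := IH (reject w v) us uvs (reject_ge0 v w0); rewrite rE => /(_ pw) IHr.
have bE : back_sum u s w = a * back_sum u s (accept w v)
                         + (1 - a) * back_sum u s (reject w v).
  rewrite /back_sum !mulr_sumr -big_split; apply: eq_bigr => z _ /=.
  rewrite /accept /reject -/a; case: ifP => _; last by ring.
  by field; lra.
apply: le_trans (lerD (ler_wpM2l a0 IHa) (ler_wpM2l (ltW a1) IHr)).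
rewrite add0r bE le_eqVlt; apply/orP; left; apply/eqP.
by field; lra.
Qed.

End Sampling.

Lemma degenerate_random_independent (R : realType) (G : sgraph) (s : seq G)
    (D : nat) (p : R) :
    triangle_free G -> uniq s -> back_bounded s D -> 0 < p < 1 / 2 ->
    4 * p * D%:R <= ln (1 / 2) - ln p ->
  forall u, u \in s -> p / 2 <= incl u s (fun=> p).
Proof.
move=> tf us bs /andP[p0 p1] pD u uin.
set L := ln (1 / 2) - ln p in pD.
have L0 : 0 < L by rewrite subr_gt0 ltr_ln ?posrE //; lra.
have := @incl_lower R G tf p L u s (fun=> p) p0 _ L0 us uin.
rewrite addrC subrK => /(_ erefl (fun=> ltW p0) (lexx _)); apply: le_trans.
rewrite ler_pM2l // subrr add0r.
suff : 2 * back_sum u s (fun=> p) / L <= 1 / 2 by lra.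
rewrite ler_pdivrMr //.
have : back_sum u s (fun=> p) <= p * D%:R.
  rewrite /back_sum big_const_seq iter_addr_0 -[leLHS]mulr_natr ler_pM2l // ler_nat.
  exact: bs.
lra.
Qed.

(** The initial weights are [p = ln D / (8 D)].  When they grow by the factor
exp (4 p D), which is the square root of [D], they still stay below 1/2.  Each vertex is then selected with probability at least [p / 2], of
order ln D / D. *)
Lemma bipartite_of_triangle_free (R : realType) (G : sgraph) (d K : nat) :
    (0 < #|G|)%N -> triangle_free G -> min_degree_at_least G d ->
    K%:R < ln (d%:R : R) / 32 ->
  has_induced_bipartite G K.+1.
Proof.
move=> n0 tf degG Kd.
have lnd : 0 < ln (d%:R : R).
  by have := ler0n R K; move: Kd; lra.
have [D [U [s [dD U0 degU us [sU bs]]]]] := degeneracy_witness n0 degG.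
have d0 : (0 < d)%N by case: d lnd {degG Kd dD} => //; rewrite ln0 ?ltxx.
have dR : 0 < d%:R :> R by rewrite ltr0n.
have D0 : 0 < D%:R :> R by rewrite ltr0n (leq_trans d0).
have lndD : ln (d%:R : R) <= ln D%:R by rewrite ler_ln ?posrE // ler_nat.
have lnD : 0 < ln (D%:R : R) by apply: lt_le_trans lndD.
pose p : R := ln D%:R / (8 * D%:R).
have p0 : 0 < p by rewrite divr_gt0 // mulr_gt0.
(* The square root of D serves to compare ln D with a power of D. *)
pose r := Num.sqrt (D%:R : R); have r0 : 0 < r by rewrite sqrtr_gt0.
have rr : r * r = D%:R by rewrite -expr2 sqr_sqrtr // ltW.
have lnDr : ln (D%:R : R) = 2 * ln r by rewrite -rr lnM ?posrE //; ring.
have lnr : ln r <= r - 1 by have := @le_ln1Dx R (r - 1); rewrite [1 + _]addrC subrK; apply; lra.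
have pr : p <= 1 / 4 / r.
  rewrite /p lnDr -rr ler_pdivrMr ?mulr_gt0 //.
  have -> : 1 / 4 / r * (8 * (r * r)) = 2 * r by field; rewrite gt_eqF.
  lra.
have pD : 4 * p * D%:R = ln D%:R / 2 by rewrite /p; field; rewrite gt_eqF.
have r1 : 1 < r.
  by rewrite -[1]sqrtr1 ltr_sqrt // ltNge; apply/negP => /ln_le0; rewrite leNgt lnD.
have p1 : p < 1 / 2.
  apply: le_lt_trans pr _; rewrite ltr_pdivrMr //; lra.
have ineq : 4 * p * D%:R <= ln (1 / 2) - ln p.
  have : ln p <= ln (1 / 2 * r^-1).
    rewrite ler_ln ?posrE ?mulr_gt0 ?invr_gt0 //; first by apply: le_trans pr _; rewrite ler_pM2r ?invr_gt0 //; lra.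
    lra.
  have -> : ln (1 / 2 * r^-1) = ln (1 / 2) - ln r.
    by rewrite lnM ?posrE ?divr_gt0 ?invr_gt0 // lnV ?posrE.
  rewrite pD lnDr; lra.
have P := degenerate_random_independent tf us bs (introT andP (conj p0 p1)) ineq.
apply: (@bipartite_of_random_independent R G U (sample s (fun=> p)) D K (p / 2)) => //.
- move=> a /(sampleP (fun=> ltW p0))[a0 sub ind]; split=> // [/ind[]//|].
  by apply/subsetP => x /sub; rewrite sU.
- by rewrite sample_total.
- by move=> x xU; rewrite sample_total mulr1; apply: P; rewrite sU.
- apply: lt_le_trans Kd _; have -> : D%:R * (p / 2) / 2 = (4 * p * D%:R) / 16 by field.
  rewrite pD; lra.
Qed.

(** * Binomial estimates *)

Lemma ffact_leq_exp n k : (n ^_ k <= n ^ k)%N.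
Proof.
by elim: k => // k IH; rewrite ffactnSr expnSr leq_mul // leq_subr.
Qed.

(** A substitute for the bound of [u ^ u] by [e ^ u * u`!]: the falling factorial
is ['C(2 * u, u) * u`!], which is at most [4 ^ u * u`!]. *)
Lemma expn_leq_ffact u : (u ^ u <= (2 * u) ^_ u)%N.
Proof.
suff H k : (k <= u)%N -> (u ^ k <= (2 * u) ^_ k)%N by apply: H.
elim: k => // k IH ku; rewrite ffactnSr expnSr; apply: leq_mul.
  exact/IH/ltnW.
by rewrite mul2n -addnn -addnBA ?leq_addr // ltnW.
Qed.

Lemma bin_leq_exp2 n k : ('C(n, k) <= 2 ^ n)%N.
Proof.
rewrite -[n in 'C(n, _)]card_ord -card_draws; apply: leq_trans (max_card _) _.
by rewrite -cardsT -powersetT card_powerset cardsT card_ord.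
Qed.

Lemma bin_leq_pow M x u : (M <= x * u)%N -> ('C(M, u) <= (4 * x) ^ u)%N.
Proof.
move=> Mx; rewrite -(leq_pmul2r (fact_gt0 u)) bin_ffact.
apply: leq_trans (ffact_leq_exp _ _) _.
apply: (@leq_trans ((x * u) ^ u)); first by case: u Mx => // u Mx; rewrite leq_exp2r.
rewrite expnMn (_ : (4 * x) ^ u * u`! = x ^ u * (4 ^ u * u`!))%N; last first.
  by rewrite expnMn; lia.
rewrite leq_mul2l; apply/orP; right; apply: leq_trans (expn_leq_ffact u) _.
rewrite -bin_ffact leq_mul2r; apply/orP; right.
by rewrite -[4%N]/(2 ^ 2)%N -expnM bin_leq_exp2.
Qed.

(** * Random subsets of a finite set *)

Lemma sum_subset_prod (R : pzSemiRingType) (P : finType) (f g : P -> R) :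
  \sum_(S : {set P}) \prod_e (if e \in S then f e else g e) = \prod_e (f e + g e).
Proof. by rewrite bigA_distr; apply: eq_bigl => S; rewrite inE. Qed.

Section RandomSubset.
Variables (R : realFieldType) (P : finType) (p : R).
Hypothesis p01 : 0 <= p <= 1.

(** The probability of [S] when each element of [P] is retained independently
with probability [p]. *)
Definition weight (S : {set P}) : R := \prod_e (if e \in S then p else 1 - p).

Definition Pr (A : pred {set P}) : R := \sum_(S | A S) weight S.

Lemma weight_ge0 S : 0 <= weight S.
Proof.
by apply: prodr_ge0 => e _; case/andP: p01 => p0 p1; case: ifP; rewrite ?subr_ge0.
Qed.

Lemma Pr_total : Pr predT = 1.
Proof.
rewrite /Pr /weight (sum_subset_prod (fun=> p) (fun=> 1 - p)) big1 // => e _.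
by rewrite addrC subrK.
Qed.

Lemma Pr_union (I : finType) (J : pred I) (A : pred {set P})
    (B : I -> pred {set P}) :
    (forall S, A S -> exists2 i, J i & B i S) ->
  Pr A <= \sum_(i | J i) Pr (B i).
Proof.
move=> AB; rewrite /Pr.
under [leRHS]eq_bigr do rewrite big_mkcond.
rewrite exchange_big big_mkcond; apply: ler_sum => S _.
have nn i : 0 <= (if B i S then weight S else 0) by case: ifP; rewrite ?weight_ge0.
case: ifP => [/AB[i Ji Bi]|_]; last exact: sumr_ge0.
by rewrite (bigD1 i) //= Bi lerDl sumr_ge0.
Qed.

Lemma Pr_or (A B C : pred {set P}) : (forall S, A S -> B S || C S) ->
  Pr A <= Pr B + Pr C.
Proof.
move=> AB; have := @Pr_union bool predT A (fun b => if b then B else C).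
rewrite big_bool; apply=> S /AB /orP[]; [exists true|exists false] => //.
Qed.

Lemma Pr_le (A B : pred {set P}) : (forall S, A S -> B S) -> Pr A <= Pr B.
Proof.
move=> AB; apply: le_trans (@Pr_or A B pred0 _) _.
  by move=> S /AB ->.
by rewrite [Pr pred0]big_pred0 ?addr0.
Qed.

Lemma Pr_superset (T : {set P}) : Pr (fun S => T \subset S) = p ^+ #|T|.
Proof.
rewrite /Pr big_mkcond /=.
transitivity (\sum_(S : {set P})
    \prod_e (if e \in S then p else if e \in T then 0 else 1 - p)).
  apply: eq_bigr => S _; case: ifPn => [/subsetP TS|/subsetPn[e eT eS]].
    apply: eq_bigr => e _; case: ifPn => // eS; case: ifP => // /TS.
    by rewrite (negPf eS).
  by rewrite (bigD1 e) //= (negPf eS) eT mul0r.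
rewrite (sum_subset_prod (fun=> p) (fun e => if e \in T then 0 else 1 - p)) /=.
rewrite -prodr_const [RHS]big_mkcond; apply: eq_bigr => e _.
by case: ifP => _; rewrite ?addr0 // addrC subrK.
Qed.

(** Exponential Markov inequality for 2 to the power of minus the intersection. *)
Lemma Pr_few (T : {set P}) (a : nat) :
  Pr (fun S => #|S :&: T| <= a)%N <= 2 ^+ a * (1 - p / 2) ^+ #|T|.
Proof.
have -> : (1 - p / 2) ^+ #|T| = \sum_S weight S * (1 / 2) ^+ #|S :&: T|.
  transitivity (\prod_e ((if e \in T then p / 2 else p) + (1 - p))).
    rewrite -prodr_const big_mkcond; apply: eq_bigr => e _.
    by case: ifP => _; field.
  rewrite -sum_subset_prod; apply: eq_bigr => S _.
  rewrite -prodr_const [\prod_(_ in S :&: T) _]big_mkcond /weight -big_split; apply: eq_bigr => e _ /=.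
  by rewrite inE; case: (e \in S); case: (e \in T) => /=; rewrite ?mulr1 // mul1r.
rewrite mulr_sumr /Pr big_mkcond; apply: ler_sum => S _.
have q0 : 0 <= (1 / 2 : R) ^+ #|S :&: T| by rewrite exprn_ge0 ?divr_ge0.
case: ifP => [Sa|_]; last by rewrite mulr_ge0 ?exprn_ge0 // mulr_ge0 ?weight_ge0.
rewrite mulrCA ler_peMr ?weight_ge0 // -(subnK Sa) exprD -mulrA -exprMn.
have -> : 2 * (1 / 2) = 1 :> R by field.
by rewrite expr1n mulr1 exprn_ege1 // ler1n.
Qed.

Lemma Pr_many (T : {set P}) (h : nat) :
  Pr (fun S => h <= #|S :&: T|)%N <= 'C(#|T|, h)%:R * p ^+ h.
Proof.
rewrite -cards_draws mulr_natl -sumr_const.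
have -> : \sum_(A in [set A : {set P} | A \subset T & #|A| == h]) p ^+ h
    = \sum_(A in [set A : {set P} | A \subset T & #|A| == h]) Pr (fun S => A \subset S).
  by apply: eq_bigr => A; rewrite inE => /andP[_ /eqP <-]; rewrite Pr_superset.
apply: Pr_union => S; rewrite -bin_gt0 -cards_draws => /card_gt0P[A].
rewrite inE => /andP[AST Ah]; have [AS AT] := subsetIP AST.
by exists A => //; rewrite inE AT.
Qed.

Definition disjoint_family (F : {set {set P}}) (u : nat) (S : {set P}) :=
  [exists E : {set {set P}},
     [&& E \subset F, #|E| == u, trivIset E & cover E \subset S]].

(** Disjointness makes the events independent, so a family of [u] disjoint
[r]-sets is contained in the random set with probability exactly
[p ^+ (r * u)]. *)
Lemma Pr_disjoint_family (F : {set {set P}}) (u r : nat) :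
    (forall t, t \in F -> #|t| = r) ->
  Pr (disjoint_family F u) <= 'C(#|F|, u)%:R * p ^+ (r * u).
Proof.
move=> Fr; rewrite -cards_draws mulr_natl -sumr_const.
pose good (E : {set {set P}}) (S : {set P}) := trivIset E && (cover E \subset S).
apply: (@le_trans _ _ (\sum_(E in [set E : {set {set P}} | E \subset F & #|E| == u])
   Pr (good E))).
  apply: Pr_union => S /existsP[E /and4P[EF Eu trE cE]].
  by exists E; rewrite ?inE ?EF // /good trE.
apply: ler_sum => E; rewrite inE => /andP[/subsetP EF /eqP Eu].
have p0 : 0 <= p by case/andP: p01.
case trE: (trivIset E); last first.
  by rewrite /Pr big_pred0 ?exprn_ge0 // => S; rewrite /good trE.
rewrite (_ : r * u = #|cover E|)%N; first by rewrite -Pr_superset; apply: Pr_le => S /andP[].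
move: trE; rewrite /trivIset => /eqP <-.
by rewrite (eq_bigr (fun=> r)) ?sum_nat_const ?Eu 1?mulnC // => t /EF/Fr.
Qed.

End RandomSubset.

Lemma one_minus_inv_pow (R : realFieldType) (n : nat) : (0 < n)%N ->
  (1 - n%:R^-1) ^+ n <= 1 / 2 :> R.
Proof.
move=> n0; set x : R := n%:R^-1.
have nR : 0 < n%:R :> R by rewrite ltr0n.
have x0 : 0 < x by rewrite invr_gt0.
have x1 : x <= 1 by rewrite invf_le1 // ler1n.
have bern k : 1 + k%:R * x <= (1 + x) ^+ k.
  elim: k => [|k IH]; first by rewrite mul0r addr0.
  rewrite exprS; apply: le_trans (ler_wpM2l _ IH); last lra.
  rewrite -natr1; have : 0 <= k%:R * x by rewrite mulr_ge0 // ltW.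
  nra.
have := bern n; rewrite /x mulfV ?gt_eqF // -/x => h2.
have h1 : (1 - x) ^+ n * (1 + x) ^+ n <= 1.
  rewrite -exprMn exprn_ile1 //; first by rewrite mulr_ge0; lra.
  nra.
have : 0 <= (1 - x) ^+ n by rewrite exprn_ge0 // subr_ge0.
nra.
Qed.

(** * Destroying all triangles by deleting disjoint ones *)

Section Deletion.
Variables (P : finType) (F : {set {set P}}) (r : nat).
Hypotheses (r0 : (0 < r)%N) (Fr : forall t, t \in F -> #|t| = r).

Definition touching (T : {set P}) : {set {set P}} := [set t in F | t :&: T != set0].

(** Delete from [S] all members of a maximal disjoint family of sets of [F]
contained in [S].  By maximality no set of [F] survives.  The elements of [T]
that disappear lie in the members of the family that meet [T], and those form a
disjoint subfamily of [touching T].  When [F] is the set of triangles, this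
lets the loss inside a given set of edges be controlled by a union bound over
disjoint, hence independent, triangles. *)
Lemma deletion (S : {set P}) : exists H : {set P},
  [/\ H \subset S, forall t, t \in F -> ~~ (t \subset H) &
   forall (T : {set P}) (a u : nat), ~~ disjoint_family (touching T) u S ->
     (a < #|S :&: T|)%N -> (a < #|H :&: T| + r * u)%N].
Proof.
pose ok (E : {set {set P}}) := [&& E \subset F, trivIset E & cover E \subset S].
have ok0 : ok set0.
  by rewrite /ok sub0set /cover big_set0 sub0set /trivIset big_set0 /cover big_set0 cards0 eqxx.
have [M /maxsetP[/and3P[MF trM cM] maxM] _] := maxset_exists ok0.
exists (S :\: cover M); split; first exact: subsetDl.
- move=> t tF; apply/negP => /subsetDP[tS tM].
  have t0 : t != set0 by rewrite -card_gt0 Fr.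
  have M0 : set0 \notin M.
    by apply/negP => /(subsetP MF)/Fr; rewrite cards0 => r_eq; move: r0; rewrite -r_eq.
  have dis B : B \in M -> [disjoint t & B].
    by move=> BM; apply: disjointWr tM; apply: bigcup_sup BM.
  have [trtM tM'] := trivIsetU1 dis trM M0.
  suff /maxM : ok (t |: M) by move/(_ (subsetUr _ _)) => eM; rewrite -eM setU11 in tM'.
  rewrite /ok trtM subUset sub1set tF MF /=.
  by rewrite /cover bigcup_setU big_set1 subUset tS.
move=> T a u; set N := M :&: touching T => nofam aS.
have Nu : (#|N| < u)%N.
  rewrite ltnNge; apply: contra nofam => uN.
  have : (0 < 'C(#|N|, u))%N by rewrite bin_gt0.
  rewrite -cards_draws => /card_gt0P[E]; rewrite inE => /andP[EN Eu].
  have EM : E \subset M := subset_trans EN (subsetIl _ _).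
  apply/existsP; exists E; rewrite Eu (subset_trans EN (subsetIr _ _)) /=.
  apply/andP; split; first exact: trivIsetS trM.
  by apply: subset_trans cM; apply/bigcupsP => B /(subsetP EM) BM; apply: bigcup_sup BM.
apply: (leq_trans aS); apply: (@leq_trans (#|(S :\: cover M) :&: T| + #|cover N|)); last first.
  rewrite leq_add2l; apply: leq_trans (leq_card_cover _) _.
  rewrite (eq_bigr (fun=> r)); first by rewrite sum_nat_const mulnC leq_mul2l ltnW ?orbT.
  by move=> t; rewrite !inE => /andP[_ /andP[tF _]]; exact: Fr.
apply: leq_trans (leq_card_setU _ _); apply/subset_leq_card/subsetP => e.
rewrite !inE => /andP[eS eT]; rewrite eS eT andbT.
case: (boolP (e \in cover M)) => //= /bigcupP[t tM et].
apply/bigcupP; exists t => //; rewrite !inE tM (subsetP MF) //=.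
by apply/set0Pn; exists e; rewrite inE et.
Qed.

Lemma card_touching (T : {set P}) (m : nat) :
  (forall e, #|[set t in F | e \in t]| <= m)%N -> (#|touching T| <= m * #|T|)%N.
Proof.
move=> Fm; apply: (@leq_trans #|\bigcup_(e in T) [set t in F | e \in t]|).
  apply/subset_leq_card/subsetP => t; rewrite inE => /andP[tF /set0Pn[e]].
  by rewrite inE => /andP[et eT]; apply/bigcupP; exists e; rewrite // inE tF.
rewrite mulnC -sum_nat_const; elim/big_rec2: _ => [|e k A _ IH]; first by rewrite cards0.
by apply: leq_trans (leq_card_setU _ _) _; apply: leq_add.
Qed.

End Deletion.

(** With edge probability [1 / N] and triangle codegree at most [N ^ 2 / 1024], a
fixed proportion of the expected number of edges in [T] survives the deletion,
except with probability exponentially small in that number.  Here [u] is about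
one sixteenth of the expectation.  The bad event is that [T] receives at most
[4 * u] edges or meets [u] disjoint triangles; otherwise, more than
[4 * u - 3 * u] edges of [T] survive. *)
Section SurvivingEdges.
Variables (R : realFieldType) (P : finType) (F : {set {set P}}) (m N : nat).
Hypotheses (F3 : forall t, t \in F -> #|t| = 3%N)
  (Fm : forall e, (#|[set t in F | e \in t]| <= m)%N)
  (N0 : (0 < N)%N) (mN : (1024 * m <= N ^ 2)%N).

Definition sparse_event (T : {set P}) (u : nat) (S : {set P}) : bool :=
  (#|S :&: T| <= 4 * u)%N || disjoint_family (touching F T) u S.

Lemma Pr_sparse_event (T : {set P}) (u : nat) : (0 < u)%N ->
    (16 * N * u <= #|T|)%N -> (#|T| <= 16 * N * u.+1)%N ->
  Pr (N%:R^-1 : R) (sparse_event T u) <= 2 * (1 / 2) ^+ (3 * u).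
Proof.
move=> u0 Tl Tu; have NR : 0 < N%:R :> R by rewrite ltr0n.
have p01 : 0 <= (N%:R^-1 : R) <= 1 by rewrite invr_ge0 ler0n invf_le1 // ler1n.
apply: le_trans (@Pr_or _ _ _ p01 (sparse_event T u) _ _ (fun S => id)) _.
rewrite [leRHS]mulr_natl mulr2n; apply: lerD.
  apply: le_trans (Pr_few p01 _ _) _.
  have -> : 1 - N%:R^-1 / 2 = 1 - (N * 2)%:R^-1 :> R by rewrite natrM invfM.
  apply: (@le_trans _ _ (2 ^+ (4 * u) * (1 / 2) ^+ (8 * u))).
    rewrite ler_pM2l ?exprn_gt0 //.
    have q0 : 0 <= 1 - (N * 2)%:R^-1 :> R.
      by rewrite subr_ge0 invf_le1 ?ltr0n ?ler1n muln_gt0 N0.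
    apply: (@le_trans _ _ ((1 - (N * 2)%:R^-1) ^+ (N * 2 * (8 * u)))).
      apply: ler_wiXn2l => //; first by rewrite lerBlDr lerDl invr_ge0.
      apply: leq_trans Tl; lia.
    rewrite exprM lerXn2r ?nnegrE ?exprn_ge0 ?divr_ge0 //.
    by apply: one_minus_inv_pow; rewrite muln_gt0 N0.
  have -> : (8 * u = 4 * u + (3 * u + u))%N by lia.
  rewrite exprD mulrA -exprMn (_ : 2 * (1 / 2) = 1); last by field.
  rewrite expr1n -[leRHS]mul1r ler_pM2l // ler_wiXn2l ?divr_ge0 ?leq_addr //; lra.
apply: le_trans (@Pr_disjoint_family _ _ _ p01 (touching F T) u 3%N _) _.
  by move=> t; rewrite inE => /andP[/F3].
apply: (@le_trans _ _ (((4 * (32 * N * m)) ^ u)%:R * N%:R^-1 ^+ (3 * u))).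
  rewrite ler_pM2r ?exprn_gt0 ?invr_gt0 // ler_nat; apply: bin_leq_pow.
  apply: leq_trans (card_touching _ Fm) _.
  by apply: (leq_trans (leq_mul (leqnn m) Tu)); nia.
rewrite natrX !(exprM _ 3) -exprMn lerXn2r ?nnegrE ?exprn_ge0 ?mulr_ge0 ?exprn_ge0 ?invr_ge0 ?divr_ge0 //.
rewrite exprVn ler_pdivrMr ?exprn_gt0 //.
have -> : (1 / 2) ^+ 3 * N%:R ^+ 3 = N%:R * (N%:R ^+ 2 / 8) :> R by field.
have : (1024 * m)%:R <= (N ^ 2)%:R :> R by rewrite ler_nat.
rewrite natrM natrX => h; nra.
Qed.

End SurvivingEdges.

(** * Edge sets as families of pairs of vertices *)

Section EdgeSets.
Variable V : finType.
Implicit Types (A e : {set V}) (x y : V) (H : {set {set V}}).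

(** Edges are two-element sets of vertices.  The random subset is drawn from all
of [{set V}], and only its two-element members are ever read; this spares a
type of edges. *)
Definition pairs A : {set {set V}} := [set e : {set V} | (e \subset A) && (#|e| == 2)].

Definition star x : {set {set V}} := [set [set x; y] | y in [set~ x]].

Definition triangles : {set {set {set V}}} :=
  [set pairs A | A in [set A : {set V} | #|A| == 3]].

Definition edge_adj H : rel V := fun x y => (x != y) && ([set x; y] \in H).

Fact edge_adj_sym H : symmetric (edge_adj H).
Proof. by move=> x y; rewrite /edge_adj eq_sym setUC. Qed.

Fact edge_adj_irr H : irreflexive (edge_adj H).
Proof. by move=> x; rewrite /edge_adj eqxx. Qed.

Definition edge_graph H : sgraph := SGraph (@edge_adj_sym H) (@edge_adj_irr H).

Lemma card_pairs A : #|pairs A| = 'C(#|A|, 2).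
Proof. exact: cards_draws. Qed.

Lemma set2_inj x : {in [set~ x] &, injective (fun y => [set x; y])}.
Proof.
move=> y z; rewrite !inE => yx zx /setP/(_ y).
by rewrite !inE eqxx orbT (negPf yx) /= => /esym/eqP.
Qed.

Lemma card_star x : #|star x| = #|V|.-1.
Proof. by rewrite card_in_imset ?cardsC1 //; exact: set2_inj. Qed.

Lemma card_triangle t : t \in triangles -> #|t| = 3.
Proof. by case/imsetP => A; rewrite inE => /eqP A3 ->; rewrite card_pairs A3. Qed.

Lemma triangle_codegree e : (#|[set t in triangles | e \in t]| <= #|V|)%N.
Proof.
apply: (@leq_trans #|[set pairs (z |: e) | z in setT]|).
  apply/subset_leq_card/subsetP => t; rewrite inE => /andP[/imsetP[A]].
  rewrite inE => /eqP A3 ->; rewrite inE => /andP[eA /eqP e2].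
  have : (0 < #|A :\: e|)%N by rewrite cardsD (setIidPr eA) A3 e2.
  case/card_gt0P => z; rewrite inE => /andP[ze zA].
  apply/imsetP; exists z => //; congr pairs; apply/eqP.
  by rewrite eq_sym eqEcard subUset sub1set zA eA cardsU1 ze A3 e2.
by apply: leq_trans (leq_imset_card _ _) _; rewrite cardsT.
Qed.

Lemma edge_graph_triangle_free H :
  (forall t, t \in triangles -> ~~ (t \subset H)) -> triangle_free (edge_graph H).
Proof.
move=> noH.
change (forall x y z : V, ~ [/\ edge_adj H x y, edge_adj H y z & edge_adj H x z]).
move=> x y z [/andP[xy xyH] /andP[yz yzH] /andP[xz xzH]].
have A3 : #|[set x; y; z]| = 3 
  by rewrite setUC cardsU1 cards2 !inE xy [z == x]eq_sym (negPf xz) [z == y]eq_sym (negPf yz).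
have /noH/negP : pairs [set x; y; z] \in triangles.
  by apply: imset_f; rewrite inE A3.
apply; apply/subsetP => e; rewrite inE => /andP[eA /cards2P[a [b [ab eE]]]].
move: eA; rewrite eE subUset !sub1set !inE => /andP[].
have yxH : [set y; x] \in H by rewrite setUC.
have zyH : [set z; y] \in H by rewrite setUC.
have zxH : [set z; x] \in H by rewrite setUC.
by move=> /orP[/orP[]|] /eqP ea /orP[/orP[]|] /eqP eb; move: ab; rewrite ea eb ?eqxx.
Qed.

Lemma edge_graph_degree H x : (#|H :&: star x| <= @degree (edge_graph H) x)%N.
Proof.
apply: leq_trans (leq_imset_card (fun y => [set x; y]) _).
apply/subset_leq_card/subsetP => e; rewrite inE => /andP[eH /imsetP[y yx eE]].
rewrite eE; apply: imset_f; rewrite inE /= /edge_adj -eE eH andbT eq_sym.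
by rewrite !inE in yx.
Qed.

Lemma edge_graph_degree_sum H A :
  (\sum_(x in A) @nbr_in (edge_graph H) A x <= 2 * #|H :&: pairs A|)%N.
Proof.
apply: (@leq_trans (\sum_(x in A) \sum_(e in H :&: pairs A) (x \in e))%N).
  apply: leq_sum => x xA; rewrite -big_mkcondr sum1_card.
  rewrite /nbr_in -(@card_in_imset _ _ (fun y => [set x; y])); last first.
    move=> y z; rewrite !inE => /andP[_ /andP[xy _]] /andP[_ /andP[xz _]].
    by apply: set2_inj; rewrite !inE eq_sym.
  apply/subset_leq_card/subsetP => e /imsetP[y]; rewrite inE => /andP[yA /andP[xy xyH]] ->.
  change (is_true (([set x; y] \in H :&: pairs A) && (x \in [set x; y]))).
  rewrite !inE eqxx /= andbT xyH /= subUset !sub1set xA yA cards2.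
  by rewrite xy.
rewrite exchange_big mulnC -sum_nat_const; apply: leq_sum => e.
rewrite !inE => /and3P[_ _ /eqP e2]; rewrite -[leqRHS]e2 -big_mkcondr sum1_card.
by apply/subset_leq_card/subsetP => x /andP[].
Qed.

Lemma edge_graph_independent H A : @independent (edge_graph H) A ->
  H :&: pairs A = set0.
Proof.
move=> iA; apply/setP => e; rewrite !inE; apply/negP => /and3P[eH eA /cards2P[a [b [ab eE]]]].
move: eA; rewrite eE subUset !sub1set => /andP[aA bA].
by have := iA _ _ aA bA; rewrite /= /edge_adj ab -eE eH.
Qed.

End EdgeSets.

(** * Random triangle-free graphs *)

Lemma subset_of_card (T : finType) (A : {set T}) (k : nat) : (k <= #|A|)%N ->
  exists2 B : {set T}, B \subset A & #|B| = k.
Proof.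
rewrite -bin_gt0 -cards_draws => /card_gt0P[B]; rewrite inE => /andP[BA /eqP Bk].
by exists B.
Qed.

(** The sum over all subsets is [(1 + y) ^+ #|V|], which is at most the inverse of
[(1 - y) ^+ #|V|], itself bounded by Bernoulli's inequality. *)
Lemma sum_nonempty_pow (R : realFieldType) (V : finType) (y : R) : 0 <= y ->
    #|V|%:R * y <= 1 / 4 ->
  \sum_(W : {set V} | W != set0) y ^+ #|W| <= 1 / 3.
Proof.
move=> y0 Vy.
have E : \sum_(W : {set V}) y ^+ #|W| = (1 + y) ^+ #|V|.
  rewrite -prodr_const addrC -(sum_subset_prod (fun=> y) (fun=> 1)).
  apply: eq_bigr => W _; rewrite -prodr_const big_mkcond.
  by [].
move: E; rewrite (bigD1 set0) //= cards0 expr0 => E.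
have bern k : k%:R * y <= 1 -> 1 - k%:R * y <= (1 - y) ^+ k.
  elim: k => [|k IH] ky; first by rewrite mul0r subr0.
  rewrite exprS; rewrite -natr1 in ky *; have k0 : 0 <= k%:R :> R by [].
  have ky0 : 0 <= k%:R * y by rewrite mulr_ge0.
  apply: le_trans (ler_wpM2l _ (IH _)); nra.
have := bern #|V|; set n := #|V| in Vy E *; move=> /(_ ltac:(lra)) h.
have k1 : (1 + y) ^+ n * (1 - y) ^+ n <= 1.
  have [n0|n0] := posnP n; first by rewrite n0 !expr0 mul1r.
  have ny : y <= n%:R * y by rewrite ler_peMl // ler1n.
  rewrite -exprMn exprn_ile1 //; nra.
have k2 : 0 <= (1 + y) ^+ n by rewrite exprn_ge0 // addr_ge0.
set Z := \sum_(_ | _) _ in E *; nra.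
Qed.

Lemma half_pow_bound (R : realFieldType) (n a b : nat) :
  (n <= 2 ^ a)%N -> (a + 3 <= b)%N -> n%:R * (2 * (1 / 2) ^+ b) <= 1 / 4 :> R.
Proof.
move=> na ab; have h0 : 0 <= (1 / 2 : R) by rewrite divr_ge0.
have nR : n%:R <= 2 ^+ a :> R by rewrite -natrX ler_nat.
apply: (@le_trans _ _ (2 ^+ a * (2 * (1 / 2) ^+ (a + 3)))).
  apply: ler_pM => //; first by rewrite mulr_ge0 ?exprn_ge0.
  by rewrite ler_pM2l // ler_wiXn2l //; lra.
have e1 : 2 ^+ a * (1 / 2) ^+ a = 1 :> R.
  by rewrite -exprMn (_ : 2 * (1 / 2) = 1) ?expr1n //; field.
rewrite exprD; set z := 2 ^+ a in e1 *; set z' := (_ ^+ a) in e1 *.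
have -> : z * (2 * (z' * (1 / 2) ^+ 3)) = z * z' / 4 by field.
by rewrite e1.
Qed.

Lemma bin_leq_expn n k : ('C(n, k) <= n ^ k)%N.
Proof.
apply: leq_trans (ffact_leq_exp n k); rewrite -bin_ffact.
by rewrite leq_pmulr // fact_gt0.
Qed.

(** The graph has [L ^ 2] vertices, numbering at most [2 ^ l], and edge
probability [1 / (32 L)].  With high probability, after the deletion of
triangles, each set of [s] vertices still spans an edge, and each vertex keeps
degree [delta], a constant multiple of [L].  Moreover each set of at most
[2 * s] vertices spans fewer than [1024 * l] edges per vertex, already before
the deletion.  An induced bipartite subgraph consists of two independent sets,
so it has at most [2 * s] vertices and cannot have large minimum degree. *)
Section RandomGraph.
Variables (L l : nat).
Hypotheses (l0 : (0 < l)%N) (Ll : (L ^ 2 <= 2 ^ l)%N)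
  (lL : (l + 3 <= 3 * ((L ^ 2).-1 %/ (512 * L)))%N).

Let delta := ((L ^ 2).-1 %/ (512 * L))%N.
Let s := (2048 * L * l)%N.
Let N := (32 * L)%N.
Let u := ('C(s, 2) %/ (16 * N))%N.

Let L0 : (0 < L)%N.
Proof. by case: posnP lL => // ->; rewrite addn3. Qed.

Let s_u : (l * s + 3 <= 3 * u)%N.
Proof.
have c2 : ('C(s, 2) * 2 = s * s.-1)%N by rewrite mulnC -mul_bin_diag bin1.
have s0 : (2048 <= s)%N by rewrite /s -mulnA leq_pmulr // muln_gt0 L0.
have : ('C(s, 2) < 16 * N * u.+1)%N by rewrite mulnC -ltn_divLR // !muln_gt0 L0.
rewrite -(@ltn_pmul2r 2) // c2 => h.
have {h} : (l * s.-1 < u.+1)%N.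
  rewrite -(@ltn_pmul2l (2048 * L)) ?muln_gt0 ?L0 // mulnA -/s.
  apply: leq_trans h _; rewrite /N; move: u.+1 => v; lia.
move: u s s0 => v t t0; have -> : t = t.-1.+1 by lia.
rewrite mulnS /=; have : (2047 * l <= l * t.-1)%N by rewrite mulnC leq_mul2l; lia.
move: (l * t.-1)%N => z; lia.
Qed.

Let u0 : (0 < u)%N.
Proof. by have := s_u; case: u => //; rewrite muln0 leqn0 addn3. Qed.

Let delta0 : (0 < delta)%N.
Proof. by move: lL; rewrite -/delta; case: delta => //; rewrite muln0 leqn0 addn3. Qed.

Let V : finType := 'I_(L ^ 2).

Let cardV : #|V| = (L ^ 2)%N. Proof. exact: card_ord. Qed.

Let p : rat := N%:R^-1.

Let N0 : (0 < N)%N. Proof. by rewrite muln_gt0 L0. Qed.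

Let p01 : 0 <= p <= 1.
Proof. by rewrite invr_ge0 ler0n invf_le1 ?ltr0n // ler1n. Qed.

Let Pr_sparse (T : {set {set V}}) (k : nat) : (0 < k)%N -> k = (#|T| %/ (16 * N))%N ->
  Pr p (sparse_event (triangles V) T k) <= 2 * (1 / 2) ^+ (3 * k).
Proof.
move=> k0 kE; apply: (@Pr_sparse_event rat {set V} (triangles V) (L ^ 2) N) => //.
- exact: card_triangle.
- by move=> e; rewrite -cardV; exact: triangle_codegree.
- by rewrite /N; nia.
- by rewrite kE mulnC leq_trunc_div.
- by rewrite kE ltnW // [X in (_ < X)%N]mulnC -ltn_divLR // muln_gt0 N0.
Qed.

Let bad_set (S : {set {set V}}) : bool :=
  [exists A : {set V}, (#|A| == s) && sparse_event (triangles V) (pairs A) u S].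

Let bad_star (S : {set {set V}}) : bool :=
  [exists x : V, sparse_event (triangles V) (star x) delta S].

Let bad_dense (S : {set {set V}}) : bool :=
  [exists W : {set V}, [&& W != set0, #|W| <= 2 * s
     & 1024 * l * #|W| <= #|S :&: pairs W|]%N].

Let Pr_bad_set : Pr p bad_set <= 1 / 4.
Proof.
pose J := [set A : {set V} | #|A| == s].
apply: (@le_trans _ _ (\sum_(A in J) Pr p (sparse_event (triangles V) (pairs A) u))).
  by apply: Pr_union => // S /existsP[A /andP[As bA]]; exists A; rewrite // inE.
apply: (@le_trans _ _ (\sum_(A in J) 2 * (1 / 2) ^+ (3 * u))).
  by apply: ler_sum => A; rewrite inE => /eqP As; apply: Pr_sparse; rewrite // card_pairs As.
rewrite sumr_const -[leLHS]mulr_natl card_draws cardV.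
apply: half_pow_bound s_u; apply: leq_trans (bin_leq_expn _ _) _.
have s0 : (0 < s)%N by rewrite /s !muln_gt0 L0.
by rewrite expnM leq_exp2r.
Qed.

Let Pr_bad_star : Pr p bad_star <= 1 / 4.
Proof.
apply: (@le_trans _ _ (\sum_(x : V) Pr p (sparse_event (triangles V) (star x) delta))).
  by apply: Pr_union => // S /existsP[A bA]; exists A.
apply: (@le_trans _ _ (\sum_(x : V) 2 * (1 / 2) ^+ (3 * delta))).
  apply: ler_sum => x _; apply: Pr_sparse => //; rewrite card_star cardV /delta /N.
  by congr (_ %/ _)%N; lia.
rewrite sumr_const -[leLHS]mulr_natl (_ : #|_| = #|V|) // cardV.
exact: half_pow_bound lL.
Qed.

Let Pr_bad_dense : Pr p bad_dense <= 1 / 3.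
Proof.
pose y : rat := (1 / 2) ^+ (2048 * l).
apply: (@le_trans _ _ (\sum_(W : {set V} | W != set0) y ^+ #|W|)); last first.
  apply: sum_nonempty_pow; first by rewrite exprn_ge0 // divr_ge0.
  have lb : (l + 3 <= 2048 * l)%N by move: l0; clear; lia.
  have := half_pow_bound rat Ll lb; rewrite cardV -/y mulrCA.
  have : 0 <= (L ^ 2)%:R * y by rewrite mulr_ge0 // exprn_ge0 // divr_ge0.
  lra.
apply: (@le_trans _ _ (\sum_(W : {set V} | (W != set0) && (#|W| <= 2 * s)%N)
    Pr p (fun S => 1024 * l * #|W| <= #|S :&: pairs W|)%N)).
  by apply: Pr_union => // S /existsP[W /and3P[W0 Ws bW]]; exists W; rewrite ?W0.
rewrite big_mkcondr; apply: ler_sum => W W0; case: ifP => Ws; last first.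
  by rewrite exprn_ge0 // exprn_ge0 // divr_ge0.
apply: le_trans (Pr_many p01 _ _) _; rewrite card_pairs.
set w := #|W| in Ws *; set h := (1024 * l * w)%N.
apply: (@le_trans _ _ (((4 * (2 * L)) ^ h)%:R * p ^+ h)).
  rewrite ler_pM2r ?exprn_gt0 ?invr_gt0 ?ltr0n // ler_nat; apply: bin_leq_pow.
  have c2 : ('C(w, 2) * 2 = w * w.-1)%N by rewrite mulnC -mul_bin_diag bin1.
  rewrite -(@leq_pmul2r 2) // c2 /h.
  apply: (@leq_trans (w * (2 * s))); first by rewrite leq_mul2l (leq_trans (leq_pred _) Ws) orbT.
  by rewrite /s; clear; lia.
rewrite natrX -exprMn (_ : _ * p = 1 / 4); last first.
  rewrite /p /N !natrM; field; rewrite pnatr_eq0; lia.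
rewrite /y -exprM (_ : 2048 * l * w = 2 * h)%N; last by rewrite /h; clear; lia.
rewrite [in leRHS]exprM (_ : (1 / 2) ^+ 2 = 1 / 4) //; field.
Qed.

Lemma random_triangle_free : exists G : sgraph, [/\ #|G| = (L ^ 2)%N,
  triangle_free G, min_degree_at_least G delta &
  ~ has_induced_bipartite G (2 * (1024 * l))].
Proof.
have [S /negP gS] : exists S, ~ (bad_set S || bad_star S || bad_dense S).
  apply: contrapT => noS.
  have : Pr p (predT : pred {set {set V}}) <= Pr p bad_set + Pr p bad_star + Pr p bad_dense.
    pose b2 (S : {set {set V}}) := bad_set S || bad_star S.
    apply: (@le_trans _ _ (Pr p b2 + Pr p bad_dense)).
      apply: Pr_or => // S _; apply: contrapT => nS; apply: noS; exists S => bS.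
      exact: nS.
    by rewrite lerD2r; apply: Pr_or.
  rewrite Pr_total //; have := Pr_bad_set; have := Pr_bad_star; have := Pr_bad_dense.
  lra.
move: gS; rewrite !negb_or => /andP[/andP[gset gstar] gdense].
have [H [HS Htri Hsurv]] := deletion (ltn0Sn 2) (@card_triangle V) S.
have surv T k : ~~ sparse_event (triangles V) T k S -> (k < #|H :&: T|)%N.
  rewrite negb_or -ltnNge => /andP[kT nofam].
  by have := Hsurv T _ _ nofam kT; move: #|H :&: T| => z; clear; lia.
exists (edge_graph H); split=> [|||].
- exact: cardV.
- exact: edge_graph_triangle_free.
- move=> x; apply: leq_trans (edge_graph_degree H x); apply/ltnW/surv.
  by apply: contra gstar => bx; apply/existsP; exists x.
move=> /has_induced_bipartiteP[A [B [AB0 iA iB degAB]]].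
have small C : @independent (edge_graph H) C -> (#|C| <= s)%N.
  move=> iC; rewrite leqNgt; apply/negP => sC.
  have [D DC Ds] := subset_of_card (ltnW sC).
  have : (u < #|H :&: pairs D|)%N.
    apply: surv; apply: contra gset => bD; apply/existsP; exists D.
    by rewrite Ds eqxx.
  by rewrite edge_graph_independent ?cards0 //; exact: independentS iC.
set W := A :|: B in AB0 degAB.
have Ws : (#|W| <= 2 * s)%N.
  by apply: leq_trans (leq_card_setU _ _) _; rewrite mul2n -addnn leq_add ?small.
have W0 : (0 < #|W|)%N by rewrite card_gt0.
have few : (#|H :&: pairs W| < 1024 * l * #|W|)%N.
  rewrite ltnNge; apply: contra gdense => dW; apply/existsP; exists W.
  rewrite AB0 Ws /=; apply: leq_trans dW _.
  by apply/subset_leq_card/setSI.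
have : (2 * (1024 * l) * #|W| <= \sum_(x in W) @nbr_in (edge_graph H) W x)%N.
  by rewrite mulnC -sum_nat_const; apply: leq_sum.
have := edge_graph_degree_sum H W; move: few.
by move: (\sum_(x in W) _)%N #|W| #|_| => x y z; clear; lia.
Qed.

End RandomGraph.

(** * A pseudorandom triangle-free graph in characteristic two *)

Lemma sum_sign_eq0 (A : finType) (f : A -> bool) (t : A -> A) :
    injective t -> (forall x, f (t x) = ~~ f x) ->
  \sum_x (-1) ^+ f x = 0 :> rat.
Proof.
move=> t_inj ft; set S := \sum_x _.
have : S = - S.
  rewrite {1}/S (reindex_inj t_inj) /= -sumrN; apply: eq_bigr => x _.
  by rewrite ft signrN.
lra.
Qed.

(** The absolute trace, the sum of the powers of [x] with exponents [2 ^ i], takes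
the values 0 and 1 and is additive.  It does not vanish identically, because it
is a polynomial of degree less than the number of elements of the field. *)
Lemma exists_trace (F : finFieldType) (k : nat) : #|F| = (2 ^ k.+1)%N ->
    (forall x : F, x + x = 0) ->
  exists2 f : F -> bool, (forall x y, f (x + y) = f x (+) f y) & exists x, f x.
Proof.
move=> Fk char2; pose tr (x : F) := \sum_(i < k.+1) x ^+ (2 ^ i).
have sqD (x y : F) : (x + y) ^+ 2 = x ^+ 2 + y ^+ 2.
  by rewrite sqrrD mulr2n char2 addr0.
have powD i (x y : F) : (x + y) ^+ (2 ^ i) = x ^+ (2 ^ i) + y ^+ (2 ^ i).
  by elim: i => [|i IH]; rewrite ?expr1 // expnSr !exprM IH sqD.
have trD x y : tr (x + y) = tr x + tr y.
  by rewrite /tr -big_split; apply: eq_bigr => i _; exact: powD.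
have tr_sq x : tr x ^+ 2 = tr x.
  have -> : tr x ^+ 2 = \sum_(i < k.+1) x ^+ (2 ^ i.+1).
    rewrite /tr; elim: k.+1 => [|j IH]; first by rewrite !big_ord0 expr0n.
    by rewrite !big_ord_recr /= sqD IH -exprM expnSr.
  rewrite big_ord_recr /= -Fk expf_card addrC /tr [RHS]big_ord_recl /= expr1.
  by congr (_ + _).
have tr01 x : tr x = (tr x != 0)%:R.
  have /eqP : tr x * (tr x - 1) = 0 by rewrite mulrBr mulr1 -expr2 tr_sq subrr.
  by rewrite mulf_eq0 subr_eq0 => /orP[] /eqP ->; rewrite ?eqxx ?oner_eq0.
exists (fun x => tr x != 0) => [x y|].
  rewrite trD {1}(tr01 x) {1}(tr01 y).
  case: (tr x != 0); case: (tr y != 0); rewrite ?addr0 ?add0r ?char2 ?oner_eq0 ?eqxx //.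
apply/existsP; apply: contraT; rewrite negb_exists => /forallP tr0.
pose q : {poly F} := \sum_(i < k.+1) 'X^(2 ^ i).
have q0 : q != 0.
  apply/eqP => /(congr1 (coefp 1)); rewrite /q /= coef0 coef_sum big_ord_recl /=.
  rewrite coefXn /= big1 ?addr0; first by move/eqP; rewrite oner_eq0.
  move=> i _; rewrite coefXn /bump /= add1n; case: eqP => // e1.
  have : (2 <= 2 ^ i.+1)%N by rewrite -{1}(expn1 2) leq_pexp2l.
  by rewrite -e1.
have sq : (size q <= (2 ^ k).+1)%N.
  apply: leq_trans (size_sum _ _ _) _; apply/bigmax_leqP => i _.
  by rewrite size_polyXn ltnS leq_pexp2l // -ltnS.
have := max_poly_roots q0 _ (enum_uniq F); rewrite -cardE Fk => /(_ _)/leq_trans.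
move=> /(_ _ _ sq); rewrite ltnS => h.
suff : (2 ^ k.+1 <= 2 ^ k)%N by rewrite leq_exp2l // ltnn.
apply: h; apply/allP => x _; rewrite /root horner_sum.
apply/eqP; transitivity (tr x); last by have := tr0 x; rewrite negbK => /eqP.
by apply: eq_bigr => i _; rewrite hornerXn.
Qed.

(** The vertices are the points of [F ^ 3].  Two of them are adjacent when their
difference is [x * (y, y^2, y^3)] with [y] nonzero and [lam x] true.  Any three
points of the punctured moment curve are linearly independent, so a triangle
would have its three sides in the same direction, and then [lam] of a sum of
three scalars summing to 0 would be true.  The graph is the Cayley graph of an
elementary abelian 2-group, so its eigenvectors are the characters
[chi (dot a u)], with values 1 and -1.  The eigenvalue at [a] only depends on
how often the cubic polynomial [dot a (curve y)] takes the values 0 and 1, that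
is, at most three times for nonzero [a]. *)
Section MomentCurveGraph.
Variables (F : finFieldType) (lam : F -> bool).
Hypotheses (char2 : forall x : F, x + x = 0)
  (lamD : forall x y, lam (x + y) = lam x (+) lam y) (lam1 : exists x, lam x).

Notation point := (F * F * F)%type.

Definition curve (y : F) : point := (y, y ^+ 2, y ^+ 3).

Definition scale (x : F) (u : point) : point := (x * u.1.1, x * u.1.2, x * u.2).

Definition gen_set : {set F * F} := [set c | lam c.1 && (c.2 != 0)].

Definition gen (c : F * F) : point := scale c.1 (curve c.2).

Definition curve_adj : rel point :=
  fun u w => [exists c in gen_set, w - u == gen c].

Let opp2 (x : F) : - x = x.
Proof. by apply/eqP; rewrite eq_sym -addr_eq0 char2. Qed.

Let oppp (u : point) : - u = u.
Proof. by case: u => [[a b] c]; congr (_, _, _) => /=; rewrite opp2. Qed.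

Let lam0 : lam 0 = false.
Proof. by have := lamD 0 0; rewrite addr0 addbb. Qed.

Lemma gen_inj : {in gen_set &, injective gen}.
Proof.
move=> [x y] [x' y']; rewrite !inE /= => /andP[lx y0] /andP[lx' y0'].
have x0 : x != 0 by apply: contraTneq lx => ->; rewrite lam0.
have x0' : x' != 0 by apply: contraTneq lx' => ->; rewrite lam0.
case=> e1 e2 _; have yy : y = y'.
  have : x * y * y = x * y * y' by rewrite -mulrA -expr2 e2 e1 expr2 mulrA.
  by apply: mulfI; rewrite mulf_neq0.
by rewrite -yy in e1 *; rewrite (mulIf y0 e1).
Qed.

Fact curve_adj_sym : symmetric curve_adj.
Proof. by move=> u w; rewrite /curve_adj -(opprB u w) (oppp (u - w)). Qed.

Fact curve_adj_irr : irreflexive curve_adj.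
Proof.
move=> u; apply/negbTE/existsP => -[[x y]]; rewrite inE /= subrr => /andP[/andP[lx y0]].
rewrite eq_sym => /eqP[/eqP]; rewrite mulf_eq0 (negPf y0) orbF => /eqP x0.
by rewrite x0 lam0 in lx.
Qed.

Definition curve_graph : sgraph := SGraph curve_adj_sym curve_adj_irr.

Lemma card_point : #|{: point}| = (#|F| ^ 3)%N.
Proof. by rewrite !card_prod !expnS expn0 muln1 mulnA. Qed.

Lemma curve_graph_triangle_free : triangle_free curve_graph.
Proof.
have vand (a b c y1 y2 y3 : F) : a != 0 -> a * y1 + b * y2 + c * y3 = 0 ->
    a * y1 ^+ 2 + b * y2 ^+ 2 + c * y3 ^+ 2 = 0 ->
    a * y1 ^+ 3 + b * y2 ^+ 3 + c * y3 ^+ 3 = 0 -> y1 != 0 -> (y1 == y2) || (y1 == y3).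
  move=> a0 e1 e2 e3 y10.
  have : a * y1 * ((y1 - y2) * (y1 - y3)) = 0.
    transitivity ((a * y1 ^+ 3 + b * y2 ^+ 3 + c * y3 ^+ 3)
      - (y2 + y3) * (a * y1 ^+ 2 + b * y2 ^+ 2 + c * y3 ^+ 2)
      + y2 * y3 * (a * y1 + b * y2 + c * y3)); first by ring.
    by rewrite e1 e2 e3 !mulr0 subrr addr0.
  by move/eqP; rewrite !mulf_eq0 (negPf a0) (negPf y10) !subr_eq0.
move=> u w z [/existsP[[x1 y1] /andP[g1 /eqP e1]] /existsP[[x2 y2] /andP[g2 /eqP e2]]
  /existsP[[x3 y3] /andP[g3 /eqP e3]]].
rewrite !inE /= in g1 g2 g3; case/andP: g1 => l1 n1; case/andP: g2 => l2 n2.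
case/andP: g3 => l3 n3.
have lam_neq x : lam x -> x != 0 by apply: contraTneq => ->; rewrite lam0.
have : gen (x1, y1) + gen (x2, y2) + gen (x3, y3) = 0.
  rewrite -e1 -e2 -e3 -[z - u]oppp; apply/eqP; rewrite subr_eq0; apply/eqP.
  by rewrite addrC addrA subrK.
move=> [h1 h2 h3].
have := vand _ _ _ _ _ _ (lam_neq _ l1) h1 h2 h3 n1.
have := vand x2 x1 x3 y2 y1 y3 (lam_neq _ l2) _ _ _ n2.
rewrite [x2 * y2 + _]addrC [x2 * y2 ^+ 2 + _]addrC [x2 * y2 ^+ 3 + _]addrC.
move=> /(_ h1 h2 h3) d2.
have := vand x3 x2 x1 y3 y2 y1 (lam_neq _ l3) _ _ _ n3.
rewrite -![x3 * _ + _ + _]addrA ![x3 * _ + _]addrC [x2 * y2 + _]addrC.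
rewrite [x2 * y2 ^+ 2 + _]addrC [x2 * y2 ^+ 3 + _]addrC.
move=> /(_ h1 h2 h3) d3 d1.
have [y12 y13] : y1 = y2 /\ y1 = y3.
  case/orP: d1 => /eqP d1; subst.
    by split => //; case/orP: d3 => /eqP ->.
  by split => //; case/orP: d2 => /eqP ->.
subst; have : (x1 + x2 + x3) * y3 = 0 by rewrite -h1 !mulrDl.
move/eqP; rewrite mulf_eq0 (negPf n3) orbF => /eqP x0.
by have := lamD (x1 + x2) x3; rewrite x0 lamD l1 l2 l3 lam0.
Qed.

Local Notation q := (#|F|).

Definition chi (z : F) : rat := (-1) ^+ lam z.

Definition dot (a u : point) : F := a.1.1 * u.1.1 + a.1.2 * u.1.2 + a.2 * u.2.

Let chiD x y : chi (x + y) = chi x * chi y.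
Proof. by rewrite /chi lamD signr_addb. Qed.

Let dotD a u w : dot a (u + w) = dot a u + dot a w.
Proof. by rewrite /dot /=; ring. Qed.

Let dotDl a b u : dot (a + b) u = dot a u + dot b u.
Proof. by rewrite /dot /=; ring. Qed.

Let dot0 u : dot 0 u = 0.
Proof. by apply: (@addrI _ (dot 0 u)); rewrite -dotDl !addr0. Qed.

Lemma sum_chi (c : F) : \sum_x chi (x * c) = if c == 0 then q%:R else 0.
Proof.
case: eqVneq => [->|c0].
  rewrite (eq_bigr (fun=> 1)) ?sumr_const // => x _.
  by rewrite mulr0 /chi lam0.
case: lam1 => t lt; apply: (@sum_sign_eq0 F (fun x => lam (x * c)) (+%R (t / c))).
  exact: addrI.
by move=> x; rewrite mulrDl divfK // lamD lt.
Qed.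

Lemma sum_chi_dot (z : point) :
  \sum_a chi (dot a z) = if z == 0 then (q ^ 3)%:R else 0.
Proof.
case: eqVneq => [->|z0].
  rewrite (eq_bigr (fun=> 1)) ?sumr_const -?card_point // => a _.
  by rewrite /dot /= !mulr0 !addr0 /chi lam0.
case: lam1 => t lt.
have [b lb] : exists b, lam (dot b z).
  case: z z0 => [[z1 z2] z3]; rewrite /dot /=.
  have [->|z1n _] := eqVneq z1 0; last first.
    by exists (t / z1, 0, 0); rewrite /= !mul0r !addr0 divfK.
  have [->|z2n _] := eqVneq z2 0; last first.
    by exists (0, t / z2, 0); rewrite /= !mul0r addr0 add0r divfK.
  have [->|z3n _] := eqVneq z3 0; first by rewrite eqxx.
  by exists (0, 0, t / z3); rewrite /= !mul0r !add0r divfK.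
apply: (@sum_sign_eq0 point (fun a => lam (dot a z)) (+%R b)); first exact: addrI.
by move=> a; rewrite dotDl lamD lb.
Qed.

Definition fourier (X : {set point}) (a : point) : rat := \sum_(u in X) chi (dot a u).

Definition curve_eigenvalue (a : point) : rat := \sum_(c in gen_set) chi (dot a (gen c)).

Definition edges (X Y : {set point}) : nat := \sum_(u in X) \sum_(w in Y) curve_adj u w.

Lemma curve_adjE u w :
  (curve_adj u w)%:R = \sum_(c in gen_set) (w - u - gen c == 0)%:R :> rat.
Proof.
case: (boolP (curve_adj u w)) => [/existsP[c /andP[cg /eqP wu]]|nadj].
  rewrite (bigD1 c) //= wu subrr eqxx big1 ?addr0 // => c' /andP[c'g c'c].
  rewrite subr_eq0; case: eqP => // /gen_inj e.
  by rewrite -e ?eqxx in c'c.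
rewrite big1 // => c cg; rewrite subr_eq0; case: eqP => // wu.
by case/existsP: nadj; exists c; rewrite cg wu eqxx.
Qed.

Lemma parseval X : \sum_a fourier X a ^+ 2 = (q ^ 3)%:R * #|X|%:R.
Proof.
transitivity (\sum_(u in X) \sum_(w in X) \sum_a chi (dot a (u + w))).
  under [RHS]eq_bigr do rewrite exchange_big; rewrite exchange_big.
  apply: eq_bigr => a _; rewrite expr2 /fourier mulr_suml; apply: eq_bigr => u _.
  by rewrite mulr_sumr; apply: eq_bigr => w _; rewrite dotD chiD.
rewrite mulr_natr -sumr_const; apply: eq_bigr => u uX.
rewrite (bigD1 u) //= sum_chi_dot -{2}(oppp u) subrr eqxx big1 ?addr0 // => w /andP[_ wu].
by rewrite sum_chi_dot -{1}(oppp w) subr_eq0 eq_sym (negPf wu).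
Qed.

Lemma edges_spectral X Y :
  (q ^ 3)%:R * (edges X Y)%:R = \sum_a fourier X a * fourier Y a * curve_eigenvalue a.
Proof.
transitivity (\sum_(u in X) \sum_(w in Y) \sum_(c in gen_set) \sum_a
    chi (dot a u) * chi (dot a w) * chi (dot a (gen c))).
  rewrite /edges natr_sum mulr_sumr; apply: eq_bigr => u _.
  rewrite natr_sum mulr_sumr; apply: eq_bigr => w _.
  rewrite curve_adjE mulr_sumr; apply: eq_bigr => c _.
  transitivity (\sum_a chi (dot a (u + w + gen c))).
    have -> : u + w + gen c = w - u - gen c by rewrite (oppp u) (oppp (gen c)) [u + w]addrC.
    rewrite sum_chi_dot.
    by case: ifP => _; rewrite ?mulr1 ?mulr0.
  by apply: eq_bigr => a _; rewrite !dotD !chiD.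
under eq_bigr do under eq_bigr do rewrite exchange_big.
under eq_bigr do rewrite exchange_big.
rewrite exchange_big; apply: eq_bigr => a _.
rewrite /fourier /curve_eigenvalue mulr_suml mulr_suml; apply: eq_bigr => u _.
rewrite -mulrA mulr_suml mulr_sumr; apply: eq_bigr => w _.
by rewrite mulrA mulr_sumr.
Qed.

Definition level (a : point) (c : F) : nat :=
  #|[set y | (y != 0) && (dot a (curve y) == c)]|.

(** The indicator function of [lam] is [(1 - chi) / 2], so its Fourier transform is
supported on 0 and 1. *)
Lemma sum_chi_lam (c : F) :
  2 * \sum_(x | lam x) chi (x * c) = q%:R * ((c == 0)%:R - (c == 1)%:R).
Proof.
transitivity (\sum_x (chi (x * c) - chi (x * (1 + c)))).
  rewrite mulr_sumr big_mkcond; apply: eq_bigr => x _.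
  have chix : chi x = if lam x then -1 else 1 by rewrite /chi; case: (lam x).
  rewrite mulrDr mulr1 chiD chix; case: ifP => _; ring.
have c1 : (1 + c == 0) = (c == 1) by rewrite addrC addr_eq0 opp2.
rewrite sumrB !sum_chi c1.
by case: (c == 0); case: (c == 1) => /=; ring.
Qed.

Lemma curve_eigenvalue_level a :
  2 * curve_eigenvalue a = q%:R * ((level a 0)%:R - (level a 1)%:R).
Proof.
have dot_gen x y : dot a (gen (x, y)) = x * dot a (curve y).
  by rewrite /dot /=; ring.
transitivity (\sum_(y | y != 0) 2 * \sum_(x | lam x) chi (x * dot a (curve y))).
  rewrite -mulr_sumr; congr (_ * _).
  rewrite /curve_eigenvalue big_mkcond (eq_bigr (fun c => if lam c.1 && (c.2 != 0)
    then chi (c.1 * dot a (curve c.2)) else 0)); last first.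
    by move=> [x y] _; rewrite inE /= dot_gen.
  rewrite -(pair_bigA _ (fun x y => if lam x && (y != 0)
    then chi (x * dot a (curve y)) else 0)) /= exchange_big [RHS]big_mkcond.
  apply: eq_bigr => y _; case: ifP => y0; last by rewrite big1 // => x _; rewrite andbF.
  by rewrite [RHS]big_mkcond; apply: eq_bigr => x _; rewrite andbT.
under eq_bigr do rewrite sum_chi_lam.
rewrite -mulr_sumr sumrB; congr (_ * (_ - _)); rewrite /level -sum1_card natr_sum;
  rewrite big_mkcond [RHS]big_mkcond; apply: eq_bigr => y _; rewrite inE.
  by case: (y != 0) => //=; case: (_ == 0).
by case: (y != 0) => //=; case: (_ == 1).
Qed.

Lemma level0 : level 0 0 = q.-1 /\ level 0 1 = 0%N.
Proof.
split.
  rewrite -(cardsC1 (0 : F)) /level; apply: eq_card => y.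
  by rewrite !inE dot0 eqxx andbT.
apply/eqP; rewrite cards_eq0; apply/eqP/setP => y; rewrite !inE dot0.
by rewrite [0 == 1]eq_sym oner_eq0 andbF.
Qed.

Lemma level_le3 a c : a != 0 -> (level a c <= 3)%N.
Proof.
move=> a0; pose p : {poly F} := Poly [:: - c; a.1.1; a.1.2; a.2].
have p0 : p != 0.
  apply: contra_neq a0 => p0.
  have := congr1 (coefp 1) p0; have := congr1 (coefp 2) p0.
  have := congr1 (coefp 3) p0; rewrite /= !coef_Poly !coef0 /=.
  by case: (a) => [[a1 a2] a3] /= -> -> ->.
have sp : (size p <= 4)%N by apply: size_Poly.
rewrite -ltnS; apply: leq_trans sp; rewrite /level cardE; apply: max_poly_roots => //.
  apply/allP => y; rewrite mem_enum inE => /andP[_ /eqP e].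
  rewrite /root horner_Poly /= -e /dot /=; apply/eqP; ring.
exact: enum_uniq.
Qed.

Lemma card_gen_set : (2 * #|gen_set| = q.-1 * q)%N.
Proof.
have -> : gen_set = setX [set x | lam x] [set y | y != 0].
  by apply/setP => c; rewrite !inE.
rewrite cardsX mulnA [RHS]mulnC; congr (_ * _)%N; last first.
  by rewrite -(cardsC1 (0 : F)); apply: eq_card => y; rewrite !inE.
apply/eqP; rewrite -(eqr_nat rat) natrM.
have := sum_chi_lam 0; rewrite eqxx eq_sym oner_eq0 subr0 mulr1 => <-.
rewrite -sum1_card natr_sum; apply/eqP; congr (_ * _).
by apply: eq_big => x; rewrite ?inE // mulr0 /chi lam0.
Qed.

Lemma fourier0 X : fourier X 0 = #|X|%:R.
Proof.
rewrite /fourier -sum1_card natr_sum; apply: eq_bigr => u _.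
by rewrite dot0 /chi lam0.
Qed.

(** The expander mixing lemma, with the arithmetic mean of the sizes in place of
the geometric one. *)
Lemma edges_mixing X Y :
  `|2 * (q ^ 3)%:R * (edges X Y)%:R - q%:R * q.-1%:R * (#|X|%:R * #|Y|%:R)|
    <= 3 * q%:R * (q ^ 3)%:R * (#|X|%:R + #|Y|%:R) / 2 :> rat.
Proof.
have -> : 2 * (q ^ 3)%:R * (edges X Y)%:R = q%:R * q.-1%:R * (#|X|%:R * #|Y|%:R)
    + \sum_(a : point | a != 0) fourier X a * fourier Y a * (2 * curve_eigenvalue a).
  rewrite -mulrA edges_spectral mulr_sumr.
  under eq_bigr do rewrite mulrCA.
  rewrite (bigD1 (0 : point)) //= !fourier0 curve_eigenvalue_level level0.1 level0.2 subr0.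
  by rewrite [q%:R * _ * _]mulrC.
rewrite addrAC subrr add0r.
apply: (@le_trans _ _ (\sum_(a : point) 3 * q%:R / 2 * (fourier X a ^+ 2 + fourier Y a ^+ 2))); last first.
  rewrite -mulr_sumr big_split /= !parseval le_eqVlt; apply/orP; left; apply/eqP; by field.
apply: le_trans (ler_norm_sum _ _ _) _.
rewrite [leRHS](bigD1 (0 : point)) //= ler_wpDl //.
  by rewrite mulr_ge0 ?addr_ge0 ?sqr_ge0 // divr_ge0 // mulr_ge0.
apply: ler_sum => a a0; rewrite curve_eigenvalue_level !normrM.
have q0 : 0 <= q%:R :> rat by [].
have lev : `|(level a 0)%:R - (level a 1)%:R| <= 3 :> rat.
  have : (level a 0)%:R <= 3%:R :> rat by rewrite ler_nat level_le3.
  have : (level a 1)%:R <= 3%:R :> rat by rewrite ler_nat level_le3.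
  have : 0 <= (level a 0)%:R :> rat by []. have : 0 <= (level a 1)%:R :> rat by [].
  rewrite ler_norml; lra.
have amgm : `|fourier X a| * `|fourier Y a| <= (fourier X a ^+ 2 + fourier Y a ^+ 2) / 2.
  rewrite -(real_normK (num_real (fourier X a))) -(real_normK (num_real (fourier Y a))).
  have := sqr_ge0 (`|fourier X a| - `|fourier Y a|); lra.
rewrite (ger0_norm q0).
apply: (@le_trans _ _ ((fourier X a ^+ 2 + fourier Y a ^+ 2) / 2 * (q%:R * 3))).
  by apply: ler_pM => //; rewrite ?mulr_ge0 // ler_wpM2l.
lra.
Qed.

Lemma edges_nbr X Y : edges X Y = (\sum_(u in X) @nbr_in curve_graph Y u)%N.
Proof. by apply: eq_bigr => u _; rewrite nbr_in_sum. Qed.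

Lemma edges_sym X Y : edges X Y = edges Y X.
Proof.
rewrite /edges exchange_big; apply: eq_bigr => u _; apply: eq_bigr => w _.
by rewrite curve_adj_sym.
Qed.

Lemma edges_independent X : @independent curve_graph X -> edges X X = 0%N.
Proof.
move=> iX; rewrite /edges big1 // => u uX; rewrite big1 // => w wX.
by have /negPf -> : ~~ curve_adj u w := iX _ _ uX wX.
Qed.

(** The mixing lemma applied to an independent set bounds its size by a multiple
of [q ^ 2].  Applied to two independent sets of such sizes, it bounds the
number of edges between them by [3 * q / 2] times the number of vertices. *)
Lemma curve_graph_no_bipartite : ~ has_induced_bipartite curve_graph (3 * q).+1.
Proof.
move=> /has_induced_bipartiteP[A [B [AB0 iA iB degAB]]].
have q0 : 0 < q%:R :> rat by rewrite ltr0n; apply/card_gt0P; exists 0.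
pose a : rat := #|A|%:R; pose b : rat := #|B|%:R; pose d : rat := q.-1%:R.
have Q3 : (q ^ 3)%:R = q%:R * q%:R ^+ 2 :> rat by rewrite natrX; ring.
have Q30 : 0 < q%:R ^+ 2 :> rat by rewrite exprn_gt0.
have small X : @independent curve_graph X -> d * #|X|%:R <= 3 * (q%:R * q%:R ^+ 2) :> rat.
  move=> iX; have := edges_mixing X X; rewrite edges_independent // mulr0 sub0r normrN.
  rewrite ger0_norm ?mulr_ge0 // -/d Q3.
  have [->|x0] := posnP #|X|; first by move=> _; rewrite mulr0n mulr0 !mulr_ge0 // ltW.
  have xR : 0 < #|X|%:R :> rat by rewrite ltr0n.
  move=> h; rewrite -(ler_pM2r xR) -(ler_pM2l q0); move: h; set x := #|X|%:R; lra.
have hA := small _ iA; have hB := small _ iB; rewrite -/a -/b in hA hB.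
have a0 : 0 <= a by []. have b0 : 0 <= b by [].
have := edges_mixing A B; rewrite ler_norml => /andP[_]; rewrite -/a -/b -/d Q3 => mix.
have eA : (3 * q%:R + 1) * a <= (edges A B)%:R.
  rewrite -natrM natr1 -natrM ler_nat edges_nbr mulnC -sum_nat_const; apply: leq_sum => u uA.
  have -> : @nbr_in curve_graph B u = @nbr_in curve_graph (A :|: B) u.
    apply: eq_card => w; rewrite !inE /=; case: (boolP (w \in A)) => //= wA.
    by have /negPf -> : ~~ curve_adj u w := iA _ _ uA wA; rewrite !andbF.
  by apply: degAB; rewrite inE uA.
have eB : (3 * q%:R + 1) * b <= (edges A B)%:R.
  rewrite -natrM natr1 -natrM ler_nat edges_sym edges_nbr mulnC -sum_nat_const; apply: leq_sum => u uB.
  have -> : @nbr_in curve_graph A u = @nbr_in curve_graph (A :|: B) u.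
    apply: eq_card => w; rewrite !inE /=; case: (boolP (w \in B)) => wB; last by rewrite orbF.
    by have /negPf -> : ~~ curve_adj u w := iB _ _ uB wB; rewrite !andbF.
  by apply: degAB; rewrite inE uB orbT.
have ab : 0 < a + b.
  rewrite -natrD ltr0n; apply: leq_trans (leq_card_setU _ _).
  by rewrite card_gt0.
have dab : d * (a * b) <= 3 * (q%:R * q%:R ^+ 2) * (a + b) / 2.
  have h1 : (d * a) * b <= 3 * (q%:R * q%:R ^+ 2) * b by rewrite ler_wpM2r.
  have h2 : (d * b) * a <= 3 * (q%:R * q%:R ^+ 2) * a by rewrite ler_wpM2r.
  lra.
set e : rat := (edges A B)%:R in mix eA eB.
have : e <= 3 * q%:R * (a + b) / 2.
  have h : q%:R * (d * (a * b)) <= q%:R * (3 * (q%:R * q%:R ^+ 2) * (a + b) / 2) by rewrite ler_pM2l.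
  rewrite -(ler_pM2l (mulr_gt0 q0 Q30)); lra.
lra.
Qed.

Lemma curve_graph_min_degree : min_degree_at_least curve_graph (q.-1 * q)./2.
Proof.
move=> u; rewrite -card_gen_set mul2n doubleK -(card_in_imset gen_inj).
rewrite -(card_imset _ (addrI u)); apply/subset_leq_card/subsetP => w.
case/imsetP => _ /imsetP[c cg ->] ->; rewrite inE /= /curve_adj.
by apply/existsP; exists c; rewrite cg addrC addKr eqxx.
Qed.

End MomentCurveGraph.

Lemma pseudorandom_triangle_free (k : nat) (q := (2 ^ k.+1)%N) :
  exists G : sgraph, [/\ #|G| = (q ^ 3)%N, triangle_free G,
    min_degree_at_least G (q.-1 * q)./2 & ~ has_induced_bipartite G (3 * q).+1].
Proof.
have [F charF Fq] := @pPrimePowerField 2 k.+1 isT isT.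
have char2 (x : F) : x + x = 0.
  have /andP[_ /eqP F2] := charF; by rewrite -mulr2n -mulr_natl F2 mul0r.
have [lam lamD lam1] := exists_trace Fq char2.
exists (curve_graph char2 lamD); rewrite /q -Fq; split.
- exact: card_point.
- exact: curve_graph_triangle_free.
- exact: curve_graph_min_degree.
- exact: curve_graph_no_bipartite.
Qed.

(** * Disjoint copies and blow-ups *)

Section Copies.
Variables (c : nat) (H : sgraph).

Definition copies_adj : rel ('I_c * H) := fun u v => (u.1 == v.1) && adj u.2 v.2.

Fact copies_adj_sym : symmetric copies_adj.
Proof. by move=> u v; rewrite /copies_adj eq_sym adj_sym. Qed.

Fact copies_adj_irr : irreflexive copies_adj.
Proof. by move=> u; rewrite /copies_adj adj_irr andbF. Qed.

Definition copies : sgraph := SGraph copies_adj_sym copies_adj_irr.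

Lemma copies_triangle_free : triangle_free H -> triangle_free copies.
Proof.
by move=> tf u v w [/andP[_ uv] /andP[_ vw] /andP[_ uw]]; apply: (tf u.2 v.2 w.2).
Qed.

Lemma copies_min_degree D : min_degree_at_least H D -> min_degree_at_least copies D.
Proof.
move=> degH [i x]; apply: leq_trans (degH x) _; rewrite /degree.
have inj : injective (fun y : H => (i, y)) by move=> y z [].
rewrite -(card_imset _ inj); apply/subset_leq_card/subsetP => _ /imsetP[y xy ->].
by rewrite !inE in xy *; rewrite /= /copies_adj /= eqxx.
Qed.

Lemma copies_has_induced_bipartite k :
  has_induced_bipartite copies k -> has_induced_bipartite H k.
Proof.
move=> /has_induced_bipartiteP[A [B [/set0Pn[[i x] xAB] iA iB degAB]]].
pose slice (X : {set copies}) : {set H} := [set y | (i, y) \in X].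
apply/has_induced_bipartiteP; exists (slice A), (slice B); split.
- by apply/set0Pn; exists x; rewrite !inE in xAB *.
- move=> y z; rewrite !inE => yA zA; have := iA _ _ yA zA.
  by rewrite /= /copies_adj /= eqxx.
- move=> y z; rewrite !inE => yA zA; have := iB _ _ yA zA.
  by rewrite /= /copies_adj /= eqxx.
move=> y yAB; have yAB' : (i, y) \in A :|: B by rewrite !inE in yAB *.
apply: leq_trans (degAB _ yAB') _; rewrite /nbr_in.
have inj : injective (fun y : H => (i, y)) by move=> ? ? [].
rewrite -[leqRHS](card_imset _ inj); apply/subset_leq_card/subsetP => -[j z].
rewrite !inE => /andP[zAB /andP[/= /eqP ij yz]].
by rewrite -ij in zAB *; apply: imset_f; rewrite !inE zAB.
Qed.

End Copies.

Section BlowUp.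
Variables (W : finType) (H : sgraph) (pi : W -> H).

Definition blowup_adj : rel W := fun u v => adj (pi u) (pi v).

Fact blowup_adj_sym : symmetric blowup_adj.
Proof. by move=> u v; apply: adj_sym. Qed.

Fact blowup_adj_irr : irreflexive blowup_adj.
Proof. by move=> u; apply: adj_irr. Qed.

Definition blowup : sgraph := SGraph blowup_adj_sym blowup_adj_irr.

Lemma blowup_triangle_free : triangle_free H -> triangle_free blowup.
Proof. by move=> tf u v w; apply: tf. Qed.

Lemma card_fibers (Y : {set H}) :
  #|[set w | pi w \in Y]| = (\sum_(y in Y) #|[set w | pi w == y]|)%N.
Proof.
rewrite -sum1dep_card (partition_big pi (fun y => y \in Y)) //=.
apply: eq_bigr => y yY; rewrite -sum1dep_card; apply: eq_bigl => w.
by case: eqP => [->|]; rewrite ?yY ?andbF.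
Qed.

Lemma blowup_min_degree t D :
    (forall y, t <= #|[set w | pi w == y]|)%N ->
  min_degree_at_least H D -> min_degree_at_least blowup (t * D).
Proof.
move=> tpi degH w; rewrite /degree.
have -> : [set v | @adj blowup w v] = [set v | pi v \in [set y | adj (pi w) y]].
  by apply/setP => v; rewrite !inE.
rewrite card_fibers mulnC; apply: (@leq_trans (degree (pi w) * t)).
  by rewrite leq_mul2r degH orbT.
by rewrite /degree -sum_nat_const; apply: leq_sum.
Qed.

(** Independent sets of the blow-up project to independent sets of the base graph,
and a projected neighbourhood shrinks at most by the size of the fibres. *)
Lemma blowup_has_induced_bipartite t k : (0 < t)%N ->
    (forall y, #|[set w | pi w == y]| <= t)%N ->
  has_induced_bipartite blowup (t * k) -> has_induced_bipartite H k.
Proof.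
move=> t0 tpi /has_induced_bipartiteP[A [B [AB0 iA iB degAB]]].
have iI (X : {set W}) : @independent blowup X -> independent (pi @: X).
  by move=> iX _ _ /imsetP[u uX ->] /imsetP[v vX ->]; exact: (iX u v).
apply/has_induced_bipartiteP; exists (pi @: A), (pi @: B); rewrite -imsetU; split.
- by case/set0Pn: AB0 => w wAB; apply/set0Pn; exists (pi w); apply: imset_f.
- exact: iI.
- exact: iI.
move=> _ /imsetP[w wAB ->]; have := degAB _ wAB.
suff : (nbr_in (A :|: B : {set blowup}) w <= nbr_in (pi @: (A :|: B)) (pi w) * t)%N.
  move=> h1 h2; rewrite -(leq_pmul2l t0) mulnC [X in (_ <= X)%N]mulnC.
  by rewrite [(k * t)%N]mulnC; apply: leq_trans h1.
set Y := [set y in pi @: (A :|: B) | adj (pi w) y].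
apply: (@leq_trans #|[set v | pi v \in Y]|).
  apply/subset_leq_card/subsetP => v; rewrite inE => /andP[vAB wv].
  by rewrite !inE imset_f.
by rewrite card_fibers /nbr_in -sum_nat_const; apply: leq_sum.
Qed.

End BlowUp.

Lemma balanced_map (T : finType) (n : nat) : (0 < #|T|)%N ->
  exists pi : 'I_n -> T, forall y,
    (n %/ #|T| <= #|[set i | pi i == y]| <= (n %/ #|T|).+1)%N.
Proof.
move=> T0; set m := #|T|; set t := (n %/ m)%N.
exists (fun i => enum_val (Ordinal (ltn_pmod i T0))) => y.
have fE (i : 'I_n) : (enum_val (Ordinal (ltn_pmod i T0)) == y) = (i %% m == enum_rank y)%N.
  by rewrite -(inj_eq enum_rank_inj) enum_valK -val_eqE.
have rm : (enum_rank y < m)%N := ltn_ord _.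
have tn : (t * m <= n)%N := leq_trunc_div _ _.
apply/andP; split.
  have lt (j : 'I_t) : (j * m + enum_rank y < n)%N.
    apply: leq_trans tn; apply: (@leq_trans (j.+1 * m)); last by rewrite leq_mul2r ltn_ord orbT.
    by rewrite mulSn addnC ltn_add2r.
  pose f (j : 'I_t) := Ordinal (lt j).
  have finj : injective f.
    move=> j j' /(congr1 val) /= /addIn /eqP; rewrite eqn_mul2r -[m == 0%N]negbK -lt0n T0 /=.
    by move/eqP/val_inj.
  rewrite -[leqLHS]card_ord -(card_imset _ finj).
  apply/subset_leq_card/subsetP => _ /imsetP[j _ ->]; rewrite inE fE /=.
  by rewrite modnMDl modn_small.
have lt (i : 'I_n) : (i %/ m < t.+1)%N by rewrite ltnS leq_div2r // ltnW.
rewrite -[t.+1]card_ord -(@card_in_imset _ _ (fun i => Ordinal (lt i))).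
  exact: max_card.
move=> i j; rewrite !inE !fE => /eqP ei /eqP ej /(congr1 val) /= eij.
by apply: val_inj; rewrite /= (divn_eq i m) (divn_eq j m) eij ei ej.
Qed.

(** * Bounds on g as a natural number *)

Lemma has_induced_bipartite_le (G : sgraph) (k K : nat) : (k <= K)%N ->
  has_induced_bipartite G K -> has_induced_bipartite G k.
Proof.
by move=> kK [U [U0 bU degU]]; exists U; split=> // x; apply: leq_trans (degU x).
Qed.

Lemma g_le (G : sgraph) (d K : nat) :
    triangle_free G -> min_degree_at_least G d -> ~ has_induced_bipartite G K ->
  (g #|G| d <= K)%N.
Proof.
move=> tf degG noK; apply/bigmax_leqP => k /asboolP/(_ G erefl tf degG) kG.
by rewrite leqNgt; apply/negP => /ltnW/has_induced_bipartite_le/(_ kG).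
Qed.

Lemma g_le_n (n d : nat) : (g n d <= n)%N.
Proof. by apply/bigmax_leqP => k _; rewrite -ltnS. Qed.

(** Every upper bound on [g] arises from this one: [c] disjoint copies of a base
graph, blown up evenly to [n] vertices. *)
Lemma g_le_blowup (H : sgraph) (n d c D k : nat) (t := (n %/ (c * #|H|))%N) :
    triangle_free H -> min_degree_at_least H D -> ~ has_induced_bipartite H k ->
    (0 < c)%N -> (0 < #|H|)%N -> (d <= t * D)%N ->
  (g n d <= t.+1 * k)%N.
Proof.
move=> tf degH noH c0 H0 dt.
have card_copies : #|copies c H| = (c * #|H|)%N by rewrite card_prod card_ord.
have [|pi piP] := @balanced_map (copies c H) n; first by rewrite card_copies muln_gt0 c0.
rewrite card_copies -/t in piP.
have -> : n = #|blowup pi| by rewrite card_ord.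
apply: g_le.
- exact/blowup_triangle_free/copies_triangle_free.
- move=> w; apply: leq_trans dt _.
  apply: (@blowup_min_degree _ _ pi t D); last exact: copies_min_degree.
  by move=> y; case/andP: (piP y).
- move=> hib; apply: noH; apply: (@copies_has_induced_bipartite c).
  by apply: blowup_has_induced_bipartite hib => // y; case/andP: (piP y).
Qed.

Lemma g_antimono (n d d' : nat) : (d <= d')%N -> (g n d <= g n d')%N.
Proof.
move=> dd; apply/bigmax_leqP => k /asboolP fk.
rewrite /g; apply: (leq_bigmax_cond (P := fun k : 'I_n.+1 => `[< forces_induced_bipartite n d' k >]) k).
apply/asboolP => G Gn tf degG; apply: fk => // x; exact: leq_trans (degG x).
Qed.

Lemma g_gt_sq (n d K : nat) : (0 < n)%N -> (d.*2 <= n)%N ->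
  (K * (2 * n) < d ^ 2)%N -> (K.+1 <= g n d)%N.
Proof.
move=> n0 dn Kd; have [_] := gP n0 dn; apply=> G Gn tf degG.
by apply: bipartite_of_neighbourhoods degG _; rewrite ?Gn.
Qed.

Lemma g_gt_log (R : realType) (n d K : nat) : (0 < n)%N -> (d.*2 <= n)%N ->
  K%:R < ln (d%:R : R) / 32 -> (K.+1 <= g n d)%N.
Proof.
move=> n0 dn Kd; have [_] := gP n0 dn; apply=> G Gn tf degG.
by apply: bipartite_of_triangle_free degG Kd; rewrite ?Gn.
Qed.

(** Since [L ^ 2] is at most [2 ^ (2 * up_log 2 L)], the parameter [l] can be taken
to be [2 * up_log 2 L]; then [L] has to dominate a multiple of its own
logarithm. *)
Lemma random_graph_log : exists B, (1 < B)%N /\ forall L, (B <= L)%N ->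
  exists (G : sgraph) (delta : nat), [/\ #|G| = (L ^ 2)%N, triangle_free G,
    min_degree_at_least G delta, (L <= 1024 * delta)%N &
    ~ has_induced_bipartite G (4096 * up_log 2 L)].
Proof.
exists (2 ^ 15)%N; split; first by rewrite -[1%N]/(2 ^ 0)%N ltn_exp2l.
move=> L BL; set a := up_log 2 L.
have L1 : (1 < L)%N by apply: leq_trans BL; rewrite -[2%N]/(2 ^ 1)%N leq_exp2l.
have /andP[aL La] := up_log_bounds (isT : (1 < 2)%N) L1; rewrite -/a in aL La.
have a15 : (15 <= a)%N by rewrite -(@leq_exp2l 2) //; apply: leq_trans La.
have big : (512 * (a + 6) < L)%N.
  apply: leq_ltn_trans aL; have grow b : (512 * (b + 21) <= 2 ^ (b + 14))%N.
    elim: b => [|b IH]; first by rewrite leq_eqVlt orbC.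
    by rewrite [X in (_ <= 2 ^ X)%N]addSn expnS; move: (2 ^ (b + 14))%N IH => z; clear; lia.
  have := grow (a - 15)%N; rewrite (_ : a - 15 + 14 = a.-1)%N; last by move: a15; clear; lia.
  by apply: leq_trans; move: a15; clear; lia.
have L0 : (0 < L)%N by apply: ltnW.
set delta := ((L ^ 2).-1 %/ (512 * L))%N.
have da : (a + 5 <= delta)%N.
  rewrite leq_divRL ?muln_gt0 //; move: big L0; clear; rewrite -mulnn.
  move: (a + 5)%N (addnS a 5) => b ->; nia.
have lL : (2 * a + 3 <= 3 * delta)%N by move: da; clear; lia.
have l0 : (0 < 2 * a)%N by move: a15; clear; lia.
have Ll : (L ^ 2 <= 2 ^ (2 * a))%N by rewrite mulnC expnM leq_exp2r.
have [G [GL tf degG noG]] := random_triangle_free l0 Ll lL.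
exists G, delta; split=> //; last first.
  by rewrite (_ : 4096 * a = 2 * (1024 * (2 * a)))%N //; clear; lia.
have : ((L ^ 2).-1 < 512 * L * delta.+1)%N.
  by rewrite mulnC -ltn_divLR // muln_gt0.
rewrite -mulnn => h.
have : (L * L <= L * (512 * delta.+1))%N.
  by move: h; rewrite [(512 * L)%N]mulnC -mulnA; case: (L * L)%N.
by rewrite leq_pmul2l // => h'; move: h' da; clearbody delta; clear; lia.
Qed.

(** * Bounds on g in terms of logarithms *)

Lemma leq_succ_double a b : (0 < a)%N -> (a.+1 * b <= 2 * a * b)%N.
Proof. by move=> a0; rewrite leq_mul2r mul2n -addnn -addn1 leq_add2l a0 orbT. Qed.

Section Bounds.
Variable R : realType.
Implicit Types n d : nat.

Lemma ln_ge_1BV (x : R) : 0 < x -> 1 - x^-1 <= ln x.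
Proof.
move=> x0; have := @le_ln1Dx R (x^-1 - 1); rewrite [1 + _]addrC subrK lnV ?posrE //.
have : 0 < x^-1 by rewrite invr_gt0.
move=> h /(_ ltac:(lra)); lra.
Qed.

(** 3 is larger than the sixth power of 6/5, whose logarithm is at least 1. *)
Lemma ln3_gt1 : 1 < ln (3 : R).
Proof.
have h : (6 / 5 : R) ^+ 6 < 3 by rewrite -subr_gt0; lra.
have p : 0 < 6 / 5 :> R by lra.
apply: (@le_lt_trans _ _ (ln ((6 / 5 : R) ^+ 6))); last first.
  by rewrite ltr_ln ?posrE ?exprn_gt0.
rewrite lnXn // -[leRHS]mulr_natr; have := ln_ge_1BV p; rewrite invf_div; lra.
Qed.

Lemma ln_nat_ge1 d : (3 <= d)%N -> 1 < ln (d%:R : R).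
Proof.
move=> d3; apply: lt_le_trans ln3_gt1 _.
by rewrite ler_ln ?posrE ?ltr0n ?(leq_trans _ d3) // ler_nat.
Qed.

Lemma up_log_le L : (1 < L)%N -> (up_log 2 L)%:R <= 4 * ln (L%:R : R) + 1.
Proof.
move=> L1; have /andP[aL _] := up_log_bounds (isT : (1 < 2)%N) L1.
have : (up_log 2 L).-1%:R * ln 2 <= ln (L%:R : R).
  rewrite mulrC [leLHS]mulr_natr -lnXn // ler_ln ?posrE ?exprn_gt0 // ?ltr0n ?(ltnW L1) //.
  by rewrite -natrX ler_nat ltnW.
have := @ln_ge_1BV 2 ltac:(lra); set x := ln 2.
have : (up_log 2 L)%:R <= (up_log 2 L).-1%:R + 1 :> R by rewrite natr1 ler_nat leqSpred.
have : 0 <= (up_log 2 L).-1%:R :> R by [].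
set y := (up_log 2 L).-1%:R; nra.
Qed.

Lemma g_lower_sq n d : (0 < n)%N -> (d.*2 <= n)%N ->
  d%:R ^+ 2 / (2 * n%:R) <= (g n d)%:R :> R.
Proof.
move=> n0 dn; rewrite leNgt; apply/negP.
rewrite ltr_pdivlMr ?mulr_gt0 ?ltr0n // -natrX -!natrM ltr_nat => h.
by have := g_gt_sq n0 dn h; rewrite ltnn.
Qed.

Lemma g_lower_log n d : (0 < n)%N -> (d.*2 <= n)%N ->
  ln (d%:R : R) / 32 <= (g n d)%:R.
Proof.
move=> n0 dn; rewrite leNgt; apply/negP => h.
by have := g_gt_log n0 dn h; rewrite ltnn.
Qed.

(** For [d ^ 2 <= n], use copies of a random graph on [L ^ 2] vertices blown up by
the constant factor [T], where [L] is proportional to [d].  The minimum degree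
grows like [T * L] and the number of vertices like [T * L ^ 2], so a large
constant [T] absorbs the loss in the minimum degree of the random graph.  Small
[d] are reduced to a constant [d0] by monotonicity. *)
Lemma g_upper_sparse : exists2 C : R, 0 < C & exists N, forall n d, (N <= n)%N ->
  (3 <= d)%N -> (d ^ 2 <= n)%N -> (g n d)%:R <= C * ln (d%:R : R).
Proof.
have [B [B1 randB]] := random_graph_log.
(* S and T are kept abstract so that these large numerals are not evaluated. *)
have [S S2 SE] : exists2 S, (1 < S)%N & S = (4 * 1024)%N by exists (4 * 1024)%N.
have [T ST] : exists T, T = (S * 1024)%N by exists (S * 1024)%N.
pose d0 := (S * B.+3)%N; have S0 : (0 < S)%N := ltnW S2.
have T0 : (0 < T)%N by rewrite ST muln_gt0 S0.
have TS : (4 * T = S * S)%N by rewrite ST mulnCA -SE.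
exists (2 * T%:R * 4096 * (4 * (1 + ln (d0%:R : R)) + 1)).
  have d00 : 0 <= ln (d0%:R : R) by rewrite ln_ge0 // ler1n muln_gt0 S0.
  by rewrite !mulr_gt0 ?ltr0n //; lra.
exists (d0 ^ 2)%N => n d nN d3 dn.
pose d1 := maxn d d0.
have d1n : (d1 ^ 2 <= n)%N by rewrite /d1 /maxn; case: ifP.
pose L := (d1 %/ S).+1.
have BL : (B <= L)%N.
  rewrite /L; apply: (@leq_trans (d0 %/ S).+1); first by rewrite mulKn //; lia.
  by rewrite ltnS leq_div2r // leq_maxr.
have L1 : (1 < L)%N.
  by rewrite /L ltnS divn_gt0 //; apply: leq_trans (leq_maxr _ _); rewrite leq_pmulr.
have d1S : (d1 < S * L)%N by rewrite mulnC ltn_ceil.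
have Ld1 : (L * S <= 2 * d1)%N.
  rewrite /L mulSn; have := leq_trunc_div d1 S.
  have : (S <= d1)%N by apply: leq_trans (leq_maxr _ _); rewrite leq_pmulr.
  clear; lia.
have [G [delta [GL tf degG Ld noG]]] := randB L BL.
have TL : (T * L ^ 2 <= n)%N.
  apply: leq_trans d1n; rewrite -(@leq_pmul2l 4) // mulnA TS -!mulnn.
  have := leq_mul Ld1 Ld1; clear; nia.
have TL0 : (0 < T * L ^ 2)%N by rewrite muln_gt0 T0.
pose c := (n %/ (T * L ^ 2))%N.
have c0 : (0 < c)%N by rewrite divn_gt0.
pose t := (n %/ (c * #|G|))%N.
have cG0 : (0 < c * #|G|)%N by rewrite GL muln_gt0 c0.
have tT : (T <= t)%N.
  by rewrite leq_divRL // GL mulnCA; apply: leq_trunc_div.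
have t2T : (t.+1 <= 2 * T)%N.
  rewrite ltn_divLR // GL; have : (n < c.+1 * (T * L ^ 2))%N by rewrite ltn_ceil.
  move=> h; apply: leq_trans h _; rewrite (_ : 2 * T * (c * L ^ 2) = (c + c) * (T * L ^ 2))%N.
    by rewrite addnn -mul2n leq_succ_double.
  by clear; lia.
have dt : (d1 <= t * delta)%N.
  apply: leq_trans (ltnW d1S) _; rewrite -(@leq_pmul2l 1024) //.
  rewrite mulnA [(1024 * S)%N]mulnC -ST mulnCA; apply: leq_mul tT _; exact: Ld.
have G0 : (0 < #|G|)%N by move: cG0; rewrite muln_gt0 => /andP[].
have gle : (g n d <= t.+1 * (4096 * up_log 2 L))%N.
  apply: (@leq_trans (g n d1)); first by rewrite g_antimono // leq_maxl.
  exact: g_le_blowup tf degG noG c0 G0 dt.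
have {}gle : (g n d <= 2 * T * (4096 * up_log 2 L))%N.
  by apply: leq_trans gle _; rewrite leq_mul2r t2T orbT.
apply: (@le_trans _ _ (2 * T * (4096 * up_log 2 L))%:R); first by rewrite ler_nat.
rewrite [leLHS](_ : _ = 2 * T%:R * (4096 * (up_log 2 L)%:R)); last by rewrite !natrM.
have := up_log_le L1; set x := (up_log 2 L)%:R => xL.
have lnd := ln_nat_ge1 d3.
have lnL : ln (L%:R : R) <= ln (d%:R : R) + ln (d0%:R : R).
  have dN : (0 < d)%N by apply: leq_trans d3.
  have d00 : (0 < d0)%N by rewrite muln_gt0 S0.
  rewrite -lnM ?posrE ?ltr0n // ler_ln ?posrE ?mulr_gt0 ?ltr0n ?(ltnW L1) //.
  rewrite -natrM ler_nat; apply: (@leq_trans d1).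
    have : (L * 2 <= L * S)%N by rewrite leq_mul2l S2 orbT.
    move=> /leq_trans/(_ Ld1); clear; lia.
  by rewrite geq_max leq_pmulr // leq_pmull // (leq_trans _ d3).
have d00 : 0 <= ln (d0%:R : R) by rewrite ln_ge0 // ler1n muln_gt0 S0.
have TR : 0 < T%:R :> R by rewrite ltr0n.
rewrite mulrA -[leRHS]mulrA ler_pM2l ?mulr_gt0 ?ltr0n //.
move: xL lnL lnd d00; clear; set y := ln (d%:R); set z := ln d0%:R; set w := ln L%:R.
move: (x : R) y z w; clear => x y z w xw wyz y1 z0.
have : z <= z * y by rewrite ler_peMr // ltW.
lra.
Qed.

(** For [n < d ^ 2], blow up a single random graph on [L ^ 2] vertices, with [L]
proportional to [n / d], by a factor [t] of order [d ^ 2 / n].  When [L] is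
bounded, [d] is linear in [n] and the trivial bound [g n d <= n] is
enough. *)
Lemma g_upper_dense : exists2 C : R, 0 < C & forall n d, (2 < d)%N ->
  (n < d ^ 2)%N -> (d.*2 <= n)%N ->
  (g n d)%:R <= C * (d%:R ^+ 2 * ln (d%:R : R) / n%:R).
Proof.
have [B [B1 randB]] := random_graph_log.
have [S SE] : exists S, S = 2048%N by exists 2048%N.
have SR : S%:R = 2048 :> R by rewrite SE.
have S0 : (0 < S)%N by rewrite SE.
pose C1 : R := (S * B)%:R ^+ 2; pose C2 : R := 4 * S%:R ^+ 3 * 2 * 10.
have C20 : 0 <= C2 by rewrite !mulr_ge0 ?exprn_ge0.
have C10 : 0 <= C1 by rewrite exprn_ge0.
exists (C1 + C2 + 1); first by rewrite ltr_wpDl ?addr_ge0.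
move=> n d d3 nd dn; have d0 : (0 < d)%N by apply: leq_trans d3.
have n0 : (0 < n)%N by apply: leq_trans dn; rewrite double_gt0.
have nR : 0 < n%:R :> R by rewrite ltr0n.
have dR : 0 < d%:R :> R by rewrite ltr0n.
have lnd := ln_nat_ge1 d3.
have main (C : R) : 0 <= C -> C <= C1 + C2 + 1 ->
    (g n d)%:R * n%:R <= C * d%:R ^+ 2 * ln (d%:R : R) ->
    (g n d)%:R <= (C1 + C2 + 1) * (d%:R ^+ 2 * ln (d%:R : R) / n%:R).
  move=> C0 CC h; rewrite mulrA ler_pdivlMr //; apply: le_trans h _.
  by rewrite -mulrA ler_wpM2r // mulr_ge0 ?exprn_ge0 //; move: lnd; clear; lra.
set L := (n %/ (S * d))%N.
have Sd0 : (0 < S * d)%N by rewrite muln_gt0 S0.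
have [LB|BL] := ltnP L B.
  apply: (main C1) => //; first by rewrite -addrA lerDl addr_ge0.
  have nB : (n <= S * B * d)%N.
    rewrite [(S * B)%N]mulnC -mulnA; apply: ltnW; apply: leq_trans (leq_mul LB (leqnn _)).
    exact: ltn_ceil.
  apply: (@le_trans _ _ (C1 * d%:R ^+ 2)); last first.
    by rewrite ler_peMr ?mulr_ge0 ?exprn_ge0 // ltW.
  rewrite /C1 -exprMn -!natrM -natrX ler_nat -mulnn leq_mul //.
  exact: leq_trans (g_le_n _ _) nB.
apply: (main C2) => //; first by rewrite addrAC lerDr addr_ge0.
have [G [delta [GL tf degG Ld noG]]] := randB L BL.
have L1 : (1 < L)%N by apply: leq_trans BL.
have L0 : (0 < L)%N := ltnW L1.
have LSd : (L * (S * d) <= n)%N by apply: leq_trunc_div.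
have LSd2 : (n <= 2 * (L * (S * d)))%N.
  have : (n < L.+1 * (S * d))%N by rewrite ltn_ceil.
  move/ltnW/leq_trans; apply.
  by rewrite [(2 * (_ * _))%N]mulnA leq_succ_double.
have Ldn : (L * d <= n)%N.
  by apply: leq_trans LSd; rewrite leq_mul2l leq_pmull // orbT.
have L2n : (L ^ 2 <= n)%N.
  rewrite -(@leq_pmul2r (d ^ 2)) ?expn_gt0 ?d0 // -expnMn.
  apply: (@leq_trans (n ^ 2)); first by rewrite leq_exp2r.
  by rewrite -mulnn leq_mul2l ltnW ?orbT.
have Ld' : (L <= d)%N.
  by rewrite -(@leq_exp2r _ _ 2) // (leq_trans L2n) // ltnW.
pose t := (n %/ (1 * #|G|))%N.
have tL : (t * L ^ 2 <= n)%N by rewrite /t mul1n GL; apply: leq_trunc_div.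
have L20 : (0 < L ^ 2)%N by rewrite expn_gt0 L0.
have t0 : (0 < t)%N by rewrite /t mul1n GL divn_gt0.
have nt : (n <= 2 * t * L ^ 2)%N.
  have : (n < t.+1 * L ^ 2)%N by rewrite /t mul1n GL ltn_ceil.
  move/ltnW/leq_trans; apply; exact: leq_succ_double.
have dt : (d <= t * delta)%N.
  have h1 : (L * (S * d) <= L * (2 * t * L))%N.
    by apply: (leq_trans LSd); apply: (leq_trans nt); rewrite -mulnn [(L * (_ * _))%N]mulnCA.
  have {h1} h2 : (S * d <= 2 * t * L)%N by rewrite leq_pmul2l in h1.
  have h3 : (t * L <= 1024 * (t * delta))%N by rewrite mulnCA leq_mul2l Ld orbT.
  move: h2 h3; rewrite SE -mulnA; move: (t * L)%N (t * delta)%N => a b; clear; lia.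
have gle : (g n d <= 2 * t * (4096 * up_log 2 L))%N.
  apply: (leq_trans (g_le_blowup tf degG noG (ltn0Sn 0) _ dt)); first by rewrite GL.
  exact: leq_succ_double.
have tn : (t * n <= (2 * S) ^ 2 * d ^ 2)%N.
  rewrite -(@leq_pmul2r n) // -mulnA.
  apply: (@leq_trans (t * (L ^ 2 * ((2 * S) ^ 2 * d ^ 2)))).
    rewrite leq_mul2l; apply/orP; right; rewrite mulnn -!expnMn leq_exp2r //.
    by apply: (leq_trans LSd2); rewrite mulnA [(2 * L)%N]mulnC -!mulnA leqnn.
  by rewrite mulnA mulnC leq_mul2l tL orbT.
have lnL : ln (L%:R : R) <= ln (d%:R : R).
  by rewrite ler_ln ?posrE ?ltr0n // ler_nat.
have := up_log_le L1; set x := (up_log 2 L)%:R => xL.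
have {}gle : (g n d)%:R <= 2 * t%:R * (4096 * x).
  by rewrite -!natrM ler_nat.
have {}tn : t%:R * n%:R <= (2 * S%:R) ^+ 2 * d%:R ^+ 2 :> R.
  by rewrite -!natrM -!natrX -natrM ler_nat.
have x5 : x <= 5 * ln (d%:R : R) by move: xL lnL lnd; clear; lra.
have x0 : 0 <= x by [].
apply: (@le_trans _ _ (2 * t%:R * (4096 * x) * n%:R)); first by rewrite ler_wpM2r // ltW.
apply: (@le_trans _ _ (2 * 4096 * x * ((2 * S%:R) ^+ 2 * d%:R ^+ 2))).
  rewrite (_ : 2 * t%:R * (4096 * x) * n%:R = 2 * 4096 * x * (t%:R * n%:R)); last by ring.
  by rewrite ler_wpM2l // !mulr_ge0.
rewrite [leRHS](_ : _ = 2 * 4096 * (5 * ln d%:R) * ((2 * S%:R) ^+ 2 * d%:R ^+ 2)); last first.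
  by rewrite /C2 SR; ring.
by rewrite ler_wpM2r ?mulr_ge0 ?exprn_ge0 ?mulr_ge0 // ler_wpM2l ?mulr_ge0.
Qed.

(** For [n ^ 2 < d ^ 3], blow up the graph on [F ^ 3], with [q] a power of 2 of order
[n / d].  The condition on [d] means that [q ^ 3 <= n], so that the blow-up
factor [t] is at least 1; the product [t * q] has order [d ^ 2 / n]. *)
Lemma g_upper_very_dense n d : (n ^ 2 < d ^ 3)%N -> (d.*2 <= n)%N ->
  (g n d)%:R <= 2048 * (d%:R ^+ 2 / n%:R) :> R.
Proof.
move=> nd dn.
have d0 : (0 < d)%N by case: d nd {dn}.
have n0 : (0 < n)%N by apply: leq_trans dn; rewrite double_gt0.
have nR : 0 < n%:R :> R by rewrite ltr0n.
rewrite mulrA ler_pdivlMr //.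
suff : (g n d * n <= 2048 * d ^ 2)%N by rewrite -(ler_nat R) !natrM.
have [small|big] := ltnP n (16 * d).
  apply: (@leq_trans (n * n)); first by rewrite leq_mul2r g_le_n orbT.
  apply: leq_trans (leq_mul (ltnW small) (ltnW small)) _.
  by rewrite -mulnn; clear; lia.
have x2 : (0 < n %/ (16 * d))%N by rewrite divn_gt0 ?muln_gt0.
have /andP[kl ku] := trunc_log_bounds (isT : (1 < 2)%N) x2.
set k := trunc_log 2 _ in kl ku; set r := (2 ^ k)%N in kl.
have r0 : (0 < r)%N by rewrite expn_gt0.
set q := (2 ^ k.+1)%N in ku; have qE : q = (2 * r)%N by rewrite /q expnS.
have q0 : (0 < q)%N by rewrite expn_gt0.
have nq : (8 * d * q <= n)%N.
  rewrite qE (_ : 8 * d * (2 * r) = r * (16 * d))%N; last by clear; lia.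
  by rewrite -leq_divRL // muln_gt0.
have qn : (n <= 16 * d * q)%N.
  by rewrite mulnC; apply: ltnW; rewrite -ltn_divLR // muln_gt0.
have [G [GL tf degG noG]] := pseudorandom_triangle_free k; rewrite -/q in GL degG noG.
have q3n : (q ^ 3 <= n)%N.
  rewrite -(@leq_pmul2r (d ^ 3)) ?expn_gt0 ?d0 // -expnMn.
  apply: (@leq_trans (n ^ 3)).
    by rewrite leq_exp2r //; apply: leq_trans nq; rewrite mulnC leq_mul2r leq_pmull // orbT.
  by rewrite expnS leq_mul2l ltnW ?orbT.
pose t := (n %/ (1 * #|G|))%N.
have tq : (t * q ^ 3 <= n)%N by rewrite /t mul1n GL; apply: leq_trunc_div.
have q30 : (0 < q ^ 3)%N by rewrite expn_gt0 q0.
have t0 : (0 < t)%N by rewrite /t mul1n GL divn_gt0.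
have nt : (n <= 2 * t * q ^ 3)%N.
  have : (n < t.+1 * q ^ 3)%N by rewrite /t mul1n GL ltn_ceil.
  move/ltnW/leq_trans; apply; exact: leq_succ_double.
have Dr : (r ^ 2 <= (q.-1 * q)./2)%N.
  rewrite qE mulnCA mul2n doubleK -mulnn leq_mul2r; apply/orP; right.
  by move: r0; clear; lia.
have dt : (d <= t * (q.-1 * q)./2)%N.
  apply: (@leq_trans (t * r ^ 2)); last by rewrite leq_mul2l Dr orbT.
  have h1 : (q * (8 * d) <= q * (2 * t * q ^ 2))%N.
    rewrite mulnC; apply: (leq_trans nq); apply: (leq_trans nt).
    by rewrite [(q * (2 * t * _))%N]mulnCA -expnS.
  have {h1} : (8 * d <= 2 * t * q ^ 2)%N by rewrite leq_pmul2l in h1.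
  by rewrite qE expnMn; move: (r ^ 2)%N => z; clear; lia.
have gle : (g n d <= 8 * (t * q))%N.
  apply: (leq_trans (g_le_blowup tf degG noG (ltn0Sn 0) _ dt)); first by rewrite GL.
  apply: (@leq_trans (2 * t * (4 * q))); last by clear; lia.
  by apply: leq_mul; move: t0 q0; rewrite -/t; clearbody t q; clear; lia.
have tqn : (t * q * n <= 256 * d ^ 2)%N.
  rewrite -(@leq_pmul2r n) //.
  apply: (@leq_trans (t * q * ((16 * d * q) * (16 * d * q)))).
    by rewrite -mulnA leq_mul2l leq_mul ?orbT.
  rewrite (_ : t * q * _ = 256 * d ^ 2 * (t * q ^ 3))%N; first by rewrite leq_mul2l tq orbT.
  by rewrite -mulnn !expnS expn0; clear; lia.
apply: (@leq_trans (8 * (t * q) * n)); first by rewrite leq_mul2r gle orbT.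
by rewrite -mulnA (_ : 2048 * d ^ 2 = 8 * (256 * d ^ 2))%N ?leq_mul2l //; clear; lia.
Qed.

Lemma ltr_sqrt_nat n d : (Num.sqrt (n%:R : R) < d%:R) = (n < d ^ 2)%N.
Proof.
rewrite -[d%:R in LHS]ger0_norm // -sqrtr_sqr -natrX.
case: (posnP (d ^ 2)%N) => [->|d0]; last by rewrite ltr_sqrt ?ltr0n // ltr_nat.
by rewrite ltn0 sqrtr0 ltNge sqrtr_ge0.
Qed.

Lemma ler_sqrt_nat n d : (d%:R <= Num.sqrt (n%:R : R)) = (d ^ 2 <= n)%N.
Proof. by rewrite leNgt ltr_sqrt_nat -leqNgt. Qed.

Lemma ler_half_nat n d : (d%:R <= (n%:R : R) / 2) = (d.*2 <= n)%N.
Proof. by rewrite ler_pdivlMr // -natrM ler_nat muln2. Qed.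

Lemma ltr_powR23_nat n d : (n%:R : R) `^ (2 / 3) < d%:R -> (n ^ 2 < d ^ 3)%N.
Proof.
move=> h; rewrite -(ltr_nat R) !natrX.
have -> : (n%:R : R) ^+ 2 = (n%:R `^ (2 / 3)) ^+ 3.
  rewrite -!powR_mulrn ?powR_ge0 // -powRrM.
  by congr (_ `^ _); field.
by rewrite ltrXn2r // powR_ge0.
Qed.

End Bounds.

(** * The growth of g *)

Theorem theorem1p3 (R : realType) :
  [/\ (* (i) *)
      exists c C : R, [/\ 0 < c, 0 < C &
        exists N : nat, forall n d : nat, (N <= n)%N -> (3 <= d)%N ->
          d%:R <= Num.sqrt (n%:R : R) ->
          c * (ln (d%:R : R) / ln (ln (d%:R : R))) <= (g n d)%:R
            <= C * ln (d%:R : R)],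
      (* (ii) *)
      (forall n d : nat,
         Num.sqrt (n%:R : R) < d%:R -> d%:R <= (n%:R : R) / 2 ->
         d%:R ^+ 2 / (2 * n%:R) <= ((g n d)%:R : R)) /\
      (exists C : R, 0 < C /\
        exists N : nat, forall n d : nat, (N <= n)%N ->
          Num.sqrt (n%:R : R) < d%:R -> d%:R <= (n%:R : R) / 2 ->
          (g n d)%:R <= C * (d%:R ^+ 2 * ln (d%:R : R) / n%:R)),
      (* (iii) *)
      forall eps : R, 0 < eps -> eps <= 1 / 2 ->
        exists c C : R, [/\ 0 < c, 0 < C &
          exists N : nat, forall n d : nat, (N <= n)%N ->
            (n%:R : R) `^ eps <= d%:R -> d%:R <= Num.sqrt (n%:R : R) ->
            c * ln (d%:R : R) <= (g n d)%:R <= C * ln (d%:R : R)]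
    & (* (iv) *)
      exists c C : R, [/\ 0 < c, 0 < C &
        exists N : nat, forall n d : nat, (N <= n)%N ->
          (n%:R : R) `^ (2 / 3) < d%:R -> d%:R <= (n%:R : R) / 2 ->
          c * (d%:R ^+ 2 / n%:R) <= (g n d)%:R <= C * (d%:R ^+ 2 / n%:R)]].
Proof.
have half n d : (d ^ 2 <= n)%N -> (2 <= n)%N -> (d.*2 <= n)%N.
  case: d => [|[|d]] dn n2 //; apply: leq_trans dn.
  by rewrite -mulnn -mul2n leq_mul2r.
have [C C0 [N gC]] := g_upper_sparse R.
split.
- have l3 := ln3_gt1 R; have ll3 : 0 < ln (ln (3 : R)) by rewrite ln_gt0.
  exists (ln (ln 3) / 32), C; split=> //; first by rewrite divr_gt0.
  exists (maxn N 2) => n d; rewrite geq_max => /andP[Nn n2] d3.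
  rewrite ler_sqrt_nat => dn; rewrite gC // andbT.
  have n0 : (0 < n)%N := ltnW n2.
  apply: le_trans (g_lower_log R n0 (half _ _ dn n2)).
  have lnd := ln_nat_ge1 R d3.
  have lln : ln (ln (3 : R)) <= ln (ln d%:R).
    have d0 : (0 < d)%N by apply: leq_trans d3.
    rewrite ler_ln ?posrE; [|lra|lra].
    by rewrite ler_ln ?posrE ?ltr0n // ler_nat.
  have y0 : 0 < ln (ln (d%:R : R)) by apply: lt_le_trans lln.
  rewrite mulrA ler_pdivrMr // mulrAC -[leRHS]mulrAC ler_pM2r ?invr_gt0 //.
  by rewrite mulrC ler_pM2l //; lra.
- split=> [n d|].
    rewrite ltr_sqrt_nat ler_half_nat => nd dn; apply: g_lower_sq => //.
    by case: n nd dn => // nd; rewrite leqn0 double_eq0 => /eqP d0; rewrite d0 in nd.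
  have [C' C'0 gC'] := g_upper_dense R; exists C'; split=> //; exists 9%N => n d n9.
  rewrite ltr_sqrt_nat ler_half_nat => nd dn; apply: gC' => //.
  by rewrite -(@ltn_exp2r _ _ 2) //; apply: ltn_trans nd; apply: leq_trans n9.
- move=> eps e0 _; exists (1 / 32), C; split=> //; first by rewrite divr_gt0.
  pose M := Num.bound ((3 : R) `^ (eps^-1)).
  exists (maxn (maxn N 2) M) => n d; rewrite !geq_max => /andP[/andP[Nn n2] Mn] nd.
  rewrite ler_sqrt_nat => dn.
  have n0 : (0 < n)%N := ltnW n2.
  have d3 : (3 <= d)%N.
    rewrite -(ler_nat R); apply: le_trans nd.
    have -> : 3%:R = ((3 : R) `^ eps^-1) `^ eps.
      by rewrite -powRrM mulVf ?gt_eqF // powRr1.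
    apply: ge0_ler_powR; rewrite ?nnegrE ?powR_ge0 ?(ltW e0) //.
    apply: ltW; apply: lt_le_trans (archi_boundP (powR_ge0 _ _)) _.
    by rewrite ler_nat.
  rewrite gC // andbT mul1r mulrC; apply: g_lower_log => //; exact: half.
- exists (1 / 2), 2048; split=> //; first by rewrite divr_gt0.
  exists 1%N => n d n0 /ltr_powR23_nat nd; rewrite ler_half_nat => dn.
  rewrite g_upper_very_dense // andbT; apply: le_trans (g_lower_sq R n0 dn).
  by rewrite le_eqVlt; apply/orP; left; apply/eqP; rewrite invfM; ring.
Qed.
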